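(* Let $p\ge2$. Assume that there exist positive constants $V_1,V_2,A_1(p)$ and $A_2(p)$ such that $$\mathbb E\big[(G_{X_1}(X_1))^2\big]\le V_1,\quad\mathbb E\big[(G_\varepsilon(\varepsilon))^2\big]\le V_2,\quad\mathbb E\big[(G_{X_1}(X_1))^p\big]\le A_1(p)\quad\text{and}\quad\mathbb E\big[(G_\varepsilon(\varepsilon))^p\big]\le A_2(p).$$ Let $V=V_1(K_{n-1}(\rho))^2+V_2\sum_{i=2}^n(K_{n-i}(\rho))^2$ and $A(p)=A_1(p)(K_{n-1}(\rho))^p+A_2(p)\sum_{i=2}^n(K_{n-i}(\rho))^p$. Then, for any $x>0$, $$\mathbb P(|S_n|>x)\le2\Big(1+\frac2p\Big)^p\frac{A(p)}{x^p}+2\exp\left(-\frac{2}{(p+2)^2e^p}\,\frac{x^2}{V}\right).$$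
   Context: $(\mathcal X,d)$ and $(\mathcal Y,\delta)$ are complete separable metric spaces; $(\varepsilon_i)_{i\ge1}$ is a sequence of iid $\mathcal Y$-valued random variables; $X_1$ is an $\mathcal X$-valued random variable independent of $(\varepsilon_i)_{i\ge2}$. The Markov chain is $X_n=F(X_{n-1},\varepsilon_n)$ for $n\ge2$, where $F:\mathcal X\times\mathcal Y\to\mathcal X$ is measurable and satisfies, for some $\rho\in[0,1)$ and $C>0$, $\mathbb E[d(F(x,\varepsilon_1),F(x',\varepsilon_1))]\le\rho\,d(x,x')$ for all $x,x'\in\mathcal X$, and $d(F(x,y),F(x,y'))\le C\,\delta(y,y')$ for all $x\in\mathcal X$, $y,y'\in\mathcal Y$. Fix $n\ge1$ and $f:\mathcal X^n\to\mathbb R$ with $|f(x_1,\ldots,x_n)-f(x_1',\ldots,x_n')|\le d(x_1,x_1')+\cdots+d(x_n,x_n')$, and let $S_n=f(X_1,\ldots,X_n)-\mathbb E[f(X_1,\ldots,X_n)]$. Let $P_{X_1}$ be the law of $X_1$, $P_\varepsilon$ the common law of the $\varepsilon_k$'s, $G_{X_1}(x)=\int d(x,x')P_{X_1}(dx')$, $G_\varepsilon(y)=\int C\,\delta(y,y')P_\varepsilon(dy')$; $G_\varepsilon(\varepsilon)$ denotes a random variable distributed as $G_\varepsilon(\varepsilon_k)$. For $k\in\mathbb N$, $K_k(\rho)=1+\rho+\cdots+\rho^k$. *)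

(* Defs.v *)
From HB Require Import structures.
From mathcomp Require Import all_boot all_order all_algebra finmap.
From mathcomp Require Import all_classical all_reals all_analysis.

Set Implicit Arguments.
Unset Strict Implicit.
Unset Printing Implicit Defensive.

Import Order.TTheory GRing.Theory Num.Theory.
Import numFieldNormedType.Exports.

Local Open Scope classical_set_scope.
Local Open Scope ring_scope.

(* The base point that comes with completeType is no restriction here: the
   state spaces carry random variables, so they are not empty. *)
#[short(type="completeMetricType")]
HB.structure Definition CompleteMetric (K : numDomainType) :=
  {M of Complete M & Metric K M}.

Definition separable_space (T : topologicalType) : Prop :=
  exists2 S : set T, countable S & dense S.

Notation borel T := (g_sigma_algebraType (@open T)).

Section independence.
Context {d d' : measure_display} {Omega : measurableType d}
  {E : measurableType d'} {R : realType} (P : probability Omega R).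

Definition independent_systems (F G : set_system Omega) : Prop :=
  forall A B, F A -> G B -> P (A `&` B) = (P A * P B)%E.

Definition sigma_family {I : Type} (D : set I) (Z : I -> {RV P >-> E}) :
    set_system Omega :=
  <<s \bigcup_(i in D) g_sigma_algebra_preimage (Z i) >>.

Definition mutually_independent {I : choiceType} (D : set I)
    (Z : I -> {RV P >-> E}) : Prop :=
  forall (J : {fset I}) (B : I -> set E), [set` J] `<=` D ->
    (forall i, measurable (B i)) ->
    P (\bigcap_(i in [set` J]) (Z i @^-1` B i)) =
    (\prod_(i <- J) P (Z i @^-1` B i))%E.

Definition identically_distributed {I : Type} (D : set I)
    (Z : I -> {RV P >-> E}) : Prop :=
  forall i j, D i -> D j -> forall B, measurable B ->
    distribution P (Z i) B = distribution P (Z j) B.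

Definition iid {I : choiceType} (D : set I) (Z : I -> {RV P >-> E}) : Prop :=
  mutually_independent D Z /\ identically_distributed D Z.

End independence.

Definition centered {d : measure_display} {Omega : measurableType d}
    {R : realType} (P : probability Omega R) (Z : Omega -> R) : Omega -> R :=
  fun w => Z w - fine 'E_P[Z].

Definition Kgeom {R : realType} (rho : R) (k : nat) : R :=
  \sum_(0 <= j < k.+1) rho ^+ j.

(* Main.v *)
Require Import Defs.
From HB Require Import structures.
From mathcomp Require Import all_boot all_order all_algebra finmap.
From mathcomp Require Import all_classical all_reals all_analysis.
From mathcomp Require Import measurable_realfun.
From mathcomp Require Import ring lra.

Set Implicit Arguments.
Unset Strict Implicit.
Unset Printing Implicit Defensive.

Import Order.TTheory GRing.Theory Num.Theory.
Import numFieldNormedType.Exports.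

Local Open Scope classical_set_scope.
Local Open Scope ring_scope.

(** Let G_1 be the mean distance of X_1 to an independent copy, G_k that of
    eps_k (times C), and Gamma_k = K_(n-k) G_k. Decompose S_n into the Doob
    martingale increments d_k, obtained by integrating out the noises one at a
    time ([doob]). Moving the k-th state of the chain by r moves the later
    ones by at most rho r, rho^2 r, ... in mean, so the k-th conditional
    expectation of f is K_(n-k)-Lipschitz in that state ([doob_lip]), and hence
    |d_k| <= Gamma_k ([doob_increment_le], [initial_increment_le]).

    The increments are not independent, but the bounds Gamma_k are functions of
    X_1, eps_2, ..., eps_n alone: each is independent of the past, and the
    argument of Fuk and Nagaev for sums of independent variables carries over.
    Put y = x p / (p + 2). On {Gamma_k <= y for all k} the exponential moment of
    S_n is a product of conditional factors, each estimated through

      e^(h d) 1{g <= y} <= 1 + h d + e^p/2 (h g)^2 + excess (g / y)^p 1{g <= y}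

    for |d| <= g ([truncated_expR_le]), where excess = e^(h y) - 1 - h y if
    h y > p and 0 otherwise. The indicator would spoil the centering of d, but
    the inequality also holds, with left-hand side 0, when g > y: the square
    term absorbs the drift. Integrating with d centered, then over the past
    ([weight_bound]), gives P(S_n > x, Gamma_k <= y for all k) <=
    exp(- h x + e^p/2 h^2 V + excess a), with a the sum of the truncated moments
    E[(Gamma_k / y)^p 1{Gamma_k <= y}] ([one_sided_tail]). A good choice of h
    brings this below a + exp(- 2 x^2 / ((p + 2)^2 e^p V))
    ([chernoff_optimization]).

    The event {Gamma_k > y for some k} is paid for once, for both signs of S_n.
    Since P(Gamma_k > y) and the truncated moment of Gamma_k together are at
    most E[(Gamma_k / y)^p] ([tail_add_truncated_moment_le]), no constant is
    lost: the power terms add up to 2 A(p) / y^p = 2 (1 + 2/p)^p A(p) / x^p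
    ([fuk_nagaev_deviation]).

    Two general facts support this. A Lipschitz function of finitely many points
    of a separable metric space is measurable for the product of the Borel
    sigma-algebras ([measurable_lipschitz_comp]). And conditioning on the past
    is a Tonelli theorem on Omega x Y, where Omega carries the sigma-algebra
    generated by X_1, eps_2, ..., eps_m: independence says that w |-> (w,
    eps_(m+1) w) pushes P to a product measure ([ge0_expectation_indep],
    [past_indep]). *)

(** * Exponential inequalities *)

Section exponential_inequalities.
Context {R : realType}.
Implicit Types u v p h x y d g a V : R.

(** Used to compare exponentials with polynomials that agree at 0. *)
Lemma le_of_derive_ge0 (g dg : R -> R) u :
  (forall x, is_derive x 1 g (dg x)) -> (forall x, 0 <= x -> 0 <= dg x) ->
  0 <= u -> g 0 <= g u.
Proof.
move=> gdg dg0 u0.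
have gd x : derivable g x 1 by case: (gdg x).
have gE x : derive1 g x = dg x by rewrite derive1E; case: (gdg x).
apply: (@ger0_derive1_ndecr R g 0 u) => // [x|].
  by rewrite in_itv/= gE => /andP[/ltW x0 _]; exact: dg0.
apply/continuous_subspaceT => x; exact/differentiable_continuous/derivable1_diffP.
Qed.

Lemma expR_ge_taylor2 u : 0 <= u -> 1 + u + u ^+ 2 / 2 <= expR u.
Proof.
move=> u0.
have := @le_of_derive_ge0 (fun x => expR x - (1 + x + x ^+ 2 / 2))
  (fun x => expR x - (1 + x)) u.
rewrite expR0; suff -> : 1 - (1 + 0 + 0 ^+ 2 / 2) = 0 :> R.
  move=> H; rewrite -subr_ge0; apply: H => //.
  + by move=> x; apply: is_derive_eq; rewrite /GRing.scale/=; field.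
  + by move=> x _; rewrite subr_ge0 expR_ge1Dx.
by field.
Qed.

Lemma expR_remainder_le_pos u : 0 <= u ->
  expR u - 1 - u <= expR u * (u ^+ 2 / 2).
Proof.
move=> u0.
have := @le_of_derive_ge0
  (fun x => expR x * (x ^+ 2 / 2) - (expR x - 1 - x))
  (fun x => expR x * (x ^+ 2 / 2) + (x * expR x - expR x + 1)) u.
rewrite expR0; suff -> : 1 * (0 ^+ 2 / 2) - (1 - 1 - 0) = 0 :> R.
  move=> H; rewrite -subr_ge0; apply: H => //.
  + by move=> x; apply: is_derive_eq; rewrite /GRing.scale/=; field.
  + move=> x x0; rewrite addr_ge0 ?mulr_ge0 ?expR_ge0 ?sqr_ge0//.
    have := expR_ge1Dx (- x); rewrite expRN => h.
    have := expR_gt0 x => e0.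
    have : (1 - x) * expR x <= 1 by rewrite -ler_pdivlMr// div1r.
    lra.
by field.
Qed.

(** From [expR_ge_taylor2] at - u, since
    (1 - u + u^2/2) (1 + u + u^2/2) = 1 + u^4/4 >= 1. *)
Lemma expR_remainder_le_neg u : u <= 0 -> expR u - 1 - u <= u ^+ 2 / 2.
Proof.
move=> u0.
have nu0 : 0 <= - u by rewrite oppr_ge0.
have := expR_ge_taylor2 nu0; rewrite sqrrN expRN => H.
have e0 := expR_gt0 u.
have {H} : (1 - u + u ^+ 2 / 2) * expR u <= 1 by rewrite -ler_pdivlMr ?div1r.
set e := expR u in e0 *; move=> H.
suff : e <= 1 + u + u ^+ 2 / 2 by lra.
have a0 : 0 < 1 - u + u ^+ 2 / 2 by nra.
rewrite -(ler_pM2l a0) (le_trans H)//.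
have : 0 <= u ^+ 2 ^+ 2 / 4 by rewrite divr_ge0 ?sqr_ge0.
lra.
Qed.

Lemma expR_remainder_le p u : 0 <= p -> u <= p ->
  expR u - 1 - u <= expR p / 2 * u ^+ 2.
Proof.
move=> p0 up; have s0 := sqr_ge0 u.
have [u0|/ltW u0] := leP 0 u.
  apply: (le_trans (expR_remainder_le_pos u0)).
  have : expR u <= expR p by rewrite ler_expR.
  move: (expR u) (expR p) => a b ab; nra.
apply: (le_trans (expR_remainder_le_neg u0)).
have : 1 <= expR p by rewrite -expR0 ler_expR.
move: (expR p) => b; nra.
Qed.

(** Beyond p the remainder e^u - 1 - u grows faster than u^p: passing from u to v
    multiplies the former by at least e^(v - u), and the latter by
    (v/u)^p <= e^(p (v/u - 1)) <= e^(v - u). *)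
Lemma expR_remainder_le_powR p u v : 0 < p -> p <= u -> u <= v ->
  expR u - 1 - u <= (expR v - 1 - v) * (u / v) `^ p.
Proof.
move=> p0 pu uv.
have u0 : 0 < u by exact: lt_le_trans pu.
have v0 : 0 < v by exact: lt_le_trans uv.
have A : expR (u - v) <= (u / v) `^ p.
  rewrite /powR gt_eqF ?divr_gt0// ler_expR.
  have -> : ln (u / v) = - ln (v / u).
    by rewrite -lnV ?posrE ?divr_gt0// invf_div.
  have : ln (v / u) <= v / u - 1.
    have -> : v / u = 1 + (v / u - 1) by rewrite addrC subrK.
    by rewrite addrAC subrr add0r le_ln1Dx// ltrBrDl subrr divr_gt0.
  have : p * (v / u - 1) <= v - u.
    have -> : v - u = u * (v / u - 1) by field; exact: lt0r_neq0.
    rewrite ler_wpM2r// subr_ge0 ler_pdivlMr// mul1r//.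
  nra.
have B : expR v - 1 - v >= expR (v - u) * (expR u - 1 - u).
  rewrite mulrBr mulrBr -expRD subrK mulr1.
  have := expR_ge1Dx (v - u); nra.
have C : 0 <= expR u - 1 - u by have := expR_ge1Dx u; lra.
have D : 0 <= expR v - 1 - v by have := expR_ge1Dx v; lra.
apply: le_trans (ler_wpM2l D A).
apply: le_trans (ler_wpM2r (expR_ge0 _) B).
by rewrite mulrAC -expRD addrC subrKA subrr expR0 mul1r.
Qed.

(** The price of an increment that may exceed p / h: such increments are compared
    with the p-th power of their bound, the others with its square. *)
Definition expR_excess p h y : R :=
  if p < h * y then expR (h * y) - 1 - h * y else 0.

Lemma expR_excess_ge0 p h y : 0 <= expR_excess p h y.
Proof.
by rewrite /expR_excess; case: ifP => // _; have := expR_ge1Dx (h * y); lra.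
Qed.

(** For g > y the left-hand side vanishes, and the right-hand side is
    nonnegative because e^p/2 >= 1/4; so, once integrated with d centered, the
    truncation on g costs nothing. *)
Lemma truncated_expR_le p h y d g : 0 < p -> 0 < h -> 0 < y -> `|d| <= g ->
  (g <= y)%R%:R * expR (h * d) <=
  1 + h * d + expR p / 2 * h ^+ 2 * g ^+ 2 +
  expR_excess p h y * ((g <= y)%R%:R * (g / y) `^ p).
Proof.
move=> p0 h0 y0 dg; have [dg1 dg2] : - g <= d /\ d <= g.
  by move: dg; rewrite ler_norml => /andP[].
have g0 : 0 <= g by exact: le_trans dg.
have ep : 1 <= expR p by rewrite -expR0 ler_expR ltW.
have hd2 : (h * d) ^+ 2 <= h ^+ 2 * g ^+ 2.
  rewrite exprMn ler_wpM2l ?sqr_ge0// -(real_normK (num_real d)).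
  by rewrite lerXn2r// nnegrE.
(* Case g > y: with c = e^p >= 1, 1 - hg + c/2 (hg)^2 >= 0. *)
have [gy|yg] := leP g y; last first.
  rewrite !mul0r mulr0 addr0.
  have hg : - (h * g) <= h * d by rewrite -mulrN ler_pM2l.
  have := sqr_ge0 (h * g - 1); rewrite -mulrA -exprMn.
  have := sqr_ge0 (h * g); move: (h * g) (h * d) (expR p) hg ep => a b c ab c1.
  nra.
rewrite !mul1r.
have [hdp|hdp] := leP (h * d) p.
  have := expR_remainder_le (ltW p0) hdp.
  have e0 := expR_ge0 p.
  have : expR p / 2 * (h * d) ^+ 2 <= expR p / 2 * h ^+ 2 * g ^+ 2.
    by rewrite -(mulrA (expR p / 2)) ler_wpM2l// divr_ge0.
  have : 0 <= expR_excess p h y * (g / y) `^ p.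
    by rewrite mulr_ge0 ?expR_excess_ge0 ?powR_ge0.
  lra.
have hdg : h * d <= h * g by rewrite ler_pM2l.
have hgy : h * g <= h * y by rewrite ler_pM2l.
have hyp : p < h * y by rewrite (lt_le_trans hdp)// (le_trans hdg).
rewrite /expR_excess hyp.
have hg0 : 0 < h * y by exact: lt_trans hyp.
have := expR_remainder_le_powR p0 (ltW hdp) (le_trans hdg hgy).
have : (h * d / (h * y)) `^ p <= (g / y) `^ p.
  have -> : h * d / (h * y) = d / y by field; rewrite !gt_eqF.
  have d0 : 0 < d by rewrite -(pmulr_rgt0 _ h0) (lt_trans p0).
  rewrite ge0_ler_powR ?nnegrE ?divr_ge0// ?(ltW p0) ?(ltW y0) ?(ltW d0)//.
  by rewrite ler_pM2r ?invr_gt0.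
have : 0 <= expR (h * y) - 1 - h * y by have := expR_ge1Dx (h * y); lra.
move: ((h * d / (h * y)) `^ p) ((g / y) `^ p) (expR (h * y) - 1 - h * y).
have : 0 <= expR p / 2 * h ^+ 2 * g ^+ 2.
  by rewrite mulr_ge0 ?sqr_ge0// mulr_ge0 ?sqr_ge0// divr_ge0// expR_ge0.
move: (expR (h * d)) (expR p / 2 * _ * _) => e m m0 a b c c0 ab.
have := ler_wpM2l c0 ab; lra.
Qed.

(** The parameter h1 minimizes the exponent of the Gaussian part, with x replaced
    by its fraction 2 x / (p + 2). It is the right choice while the excess term
    stays below h y, that is while h1 y <= max(p, ln (1 + 1/a)); otherwise h
    with h y = max(p, ln (1 + 1/a)) already brings the whole bound below a. *)
Lemma chernoff_optimization p x V a : 2 <= p -> 0 < x -> 0 < V -> 0 <= a ->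
  let y := x * p / (p + 2) in
  exists2 h, 0 < h &
  expR (- (h * x) + expR p / 2 * h ^+ 2 * V + expR_excess p h y * a) <=
  a + expR (- (2 / ((p + 2) ^+ 2 * expR p)) * (x ^+ 2 / V)).
Proof.
move=> p2 x0 V0 a0 y.
have p0 : 0 < p by lra.
have pp0 : 0 < p + 2 by lra.
have y0 : 0 < y by rewrite /y divr_gt0// mulr_gt0.
have e0 := expR_gt0 p.
pose h1 := 2 * x / ((p + 2) * (expR p * V)).
have h10 : 0 < h1 by rewrite /h1 divr_gt0 ?mulr_gt0.
have xE : x = y + 2 * y / p.
  by rewrite /y; field; rewrite !gt_eqF.
have h1E : h1 * y / p = 2 / ((p + 2) ^+ 2 * expR p) * (x ^+ 2 / V).
  by rewrite /h1 /y; field; rewrite !gt_eqF.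
(* Since y = x - 2 y / p, a parameter h <= h1 leaves the exponent - h y - h y / p:
   up to h1 the quadratic term eats at most half of 2 h y / p. *)
have quad h : 0 < h -> h <= h1 ->
    - (h * x) + expR p / 2 * h ^+ 2 * V <= - (h * y) - h * y / p.
  move=> h0 hh1.
  have : expR p / 2 * h ^+ 2 * V <= h * y / p.
    have -> : expR p / 2 * h ^+ 2 * V = h * (h * (expR p * V / 2)) by field.
    have -> : h * y / p = h * (h1 * (expR p * V / 2)).
      by rewrite /h1 /y; field; rewrite !gt_eqF.
    by rewrite ler_pM2l// ler_pM2r// divr_gt0// mulr_gt0.
  have -> : h * x = h * y + 2 * (h * y / p) by rewrite {1}xE; field; rewrite gt_eqF.
  lra.
rewrite mulNr -h1E.
have [h1p|h1p] := leP (h1 * y) p.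
  exists h1 => //; rewrite /expR_excess ltNge h1p/= mul0r addr0.
  apply: (@le_trans _ _ (expR (- (h1 * y / p)))); last by rewrite lerDr.
  rewrite ler_expR (le_trans (quad _ h10 _))//.
  have := mulr_gt0 h10 y0; lra.
have [a_eq0|/eqP a_neq0] := pselect (a = 0).
  exists h1 => //; rewrite a_eq0 mulr0 addr0 add0r.
  rewrite ler_expR (le_trans (quad _ h10 _))//.
  have := mulr_gt0 h10 y0; lra.
have {a_neq0} a_gt0 : 0 < a by rewrite lt_neqAle eq_sym a_neq0.
have a1 : 0 < 1 + a^-1 by rewrite addr_gt0 ?invr_gt0.
(* The largest value of h y for which the excess term is surely at most 1. *)
pose l := ln (1 + a^-1).
have expl : expR l = 1 + a^-1 by rewrite /l lnK ?posrE.
have exph h : h * y <= l -> (expR (h * y) - 1 - h * y) * a <= 1 - h * y * a.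
  move=> hyl; have : expR (h * y) <= 1 + a^-1 by rewrite -expl ler_expR.
  rewrite -(ler_pM2r a_gt0) mulrDl mul1r mulVf ?gt_eqF//; lra.
have [h1l|h1l] := leP (h1 * y) l.
  exists h1 => //; rewrite /expR_excess h1p.
  apply: (@le_trans _ _ (expR (- (h1 * y / p)))); last by rewrite lerDr.
  rewrite ler_expR; have := quad _ h10 (lexx _); have := exph _ h1l.
  have : 0 <= h1 * y * a by rewrite mulr_ge0// ltW// mulr_gt0.
  move: (h1 * y / p) (expR p / 2 * _ * _) (h1 * x) => A B D.
  lra.
have inva : expR (- l) <= a.
  by rewrite expRN expl invf_ple ?posrE// lerDr.
have [lp|pl] := ltP l p.
  pose h := p / y.
  have hy : h * y = p by rewrite /h divfK// gt_eqF.
  have h0 : 0 < h by rewrite divr_gt0.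
  exists h => //; rewrite /expR_excess hy ltxx mul0r addr0.
  apply: (@le_trans _ _ (expR (- l))).
    rewrite ler_expR (le_trans (quad _ h0 _))//.
      by rewrite -(ler_pM2r y0) hy ltW.
    rewrite hy divff ?gt_eqF//; lra.
  by rewrite (le_trans inva)// lerDl expR_ge0.
pose h := l / y.
have hy : h * y = l by rewrite /h divfK// gt_eqF.
have h0 : 0 < h by rewrite divr_gt0//; lra.
exists h => //; apply: (@le_trans _ _ (expR (- l))); last first.
  by rewrite (le_trans inva)// lerDl expR_ge0.
rewrite ler_expR /expR_excess.
have hh1 : h <= h1 by rewrite -(ler_pM2r y0) hy ltW.
have := quad _ h0 hh1; rewrite hy.
have lp1 : 1 <= l / p by rewrite ler_pdivlMr// mul1r.
have := exph h; rewrite hy lexx => /(_ isT).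
have : 0 <= l * a by rewrite mulr_ge0//; lra.
case: ifP => _; move: (l / p) lp1 (expR p / 2 * _ * _) (h * x) => A A1 B D; lra.
Qed.

End exponential_inequalities.

(** * Measurability of Lipschitz functions on separable spaces *)

Section lipschitz_measurable.
Context {R : realType}.

Lemma measurable_fun_of_lt d (T : measurableType d) (f : T -> R) :
  (forall a, measurable [set t | f t < a]) -> measurable_fun [set: T] f.
Proof.
move=> mf mT; apply: (measurability _ (RGenInftyO.measurableE R)) => //.
move=> /= _ [_ [a ->] <-]; rewrite setTI.
suff -> : f @^-1` `]-oo, a[ = [set t | f t < a] by [].
by apply/seteqP; split => t /=; rewrite in_itv.
Qed.

Lemma open_mdist_lt (E : completeMetricType R) (q : E) a :
  open [set x : E | mdist x q < a].
Proof.
rewrite openE => x /= xqa; apply/nbhs_ballP; exists (a - mdist x q) => /=.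
  by rewrite subr_gt0.
rewrite ballEmdist => z /= xz; rewrite (le_lt_trans (metric_triangle _ x _))//.
by rewrite (metric_sym z) -ltrBrDr.
Qed.

Lemma measurable_mdistl (E : completeMetricType R) (q : E) :
  measurable_fun [set: borel E] (fun x : borel E => mdist (x : E) q).
Proof.
apply: measurable_fun_of_lt => a; apply: sub_sigma_algebra.
exact: open_mdist_lt.
Qed.

Lemma separable_dense_seq (E : completeMetricType R) : separable_space E ->
  exists s : nat -> E, forall x e, 0 < e -> exists k, mdist x (s k) < e.
Proof.
move=> [S /pfcard_geP[->|[s]] dS].
  have [] := dS setT; [by exists point | exact: openT |].
  by move=> x [].
exists s => x e e0.
have [] := dS [set z | mdist z x < e]; [|exact: open_mdist_lt|].
  by exists x; rewrite /= mdistxx.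
move=> z [xz Sz]; have [k _ kz] := @surj _ _ _ _ s z Sz.
by exists k; rewrite kz metric_sym.
Qed.

(** McShane's formula on a countable dense set: g is the infimum over the tuples q
    of dense points of g q + c (sum of the distances to q), and each of these
    functions is measurable because single distances are. This avoids comparing
    the Borel sigma-algebra of a product with the product sigma-algebra. *)
Lemma measurable_lipschitz_comp (E : completeMetricType R)
    (sepE : separable_space E) d (T : measurableType d) (n : nat)
    (Z : nat -> T -> borel E) (g : (nat -> E) -> R) (c : R) :
  (forall i, (i < n)%N -> measurable_fun [set: T] (Z i)) ->
  0 <= c ->
  (forall x x', `|g x - g x'| <= c * \sum_(i < n) mdist (x i) (x' i)) ->
  measurable_fun [set: T] (fun t => g (fun i => Z i t)).
Proof.
move=> mZ c0 glip; apply: measurable_fun_of_lt => a.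
have [s sE] := separable_dense_seq sepE.
(* Tuples of dense points are coded by lists of indices; only the first n entries
   matter. *)
pose q (k : seq nat) (i : nat) : E := s (nth 0%N k i).
pose r k t := g (q k) + c * \sum_(i < n) mdist (Z i t : E) (q k i).
suff -> : [set t | g (fun i => Z i t) < a] =
    \bigcup_(k in [set: seq nat]) [set t | r k t < a].
  apply: countable_bigcupT_measurable => [|k]; first exact: countableP.
  rewrite -[X in measurable X]setTI.
  have mr : measurable_fun [set: T] (r k).
    apply: measurable_funD => //; apply: measurable_funM => //.
    apply: measurable_sum => i.
    exact: (measurableT_comp (measurable_mdistl (q k i)) (mZ i _)).
  rewrite (_ : [set t | _] = r k @^-1` `]-oo, a[); last first.
    by apply/seteqP; split => t /=; rewrite in_itv.
  exact: mr.
apply/seteqP; split => [t /= gta|t [k _] /=]; last first.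
  apply: le_lt_trans.
  by rewrite -lerBlDl (le_trans (ler_norm _))// glip.
pose e := (a - g (fun i => Z i t)) / (2 * (c * n%:R) + 1).
have e0 : 0 < e by rewrite divr_gt0 ?subr_gt0// ltr_wpDl// !mulr_ge0.
pose k : seq nat := mkseq (fun i => sval (cid (sE (Z i t) e e0))) n.
exists k => //=.
have kP i : (i < n)%N -> mdist (Z i t : E) (q k i) < e.
  by move=> ni; rewrite /q nth_mkseq//; exact: (svalP (cid (sE (Z i t) e e0))).
have sum_le : c * (\sum_(i < n) mdist (Z i t : E) (q k i)) <= c * n%:R * e.
  rewrite -mulrA ler_wpM2l// mulr_natl -[n in leRHS]card_ord -sumr_const.
  by apply: ler_sum => i _; exact/ltW/kP.
have := glip (q k) (fun i => Z i t).
rewrite (eq_bigr (fun i : 'I_n => mdist (Z i t : E) (q k i))); last first.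
  by move=> i _; rewrite metric_sym.
move=> /(le_trans (ler_norm _)) H.
have : a - g (fun i => Z i t) = e * (2 * (c * n%:R) + 1).
  by rewrite /e divfK// gt_eqF// ltr_wpDl// !mulr_ge0.
rewrite /r; lra.
Qed.

End lipschitz_measurable.

(** * Independence and iterated integrals *)

Section independence_tonelli.
Context d (Omega : measurableType d) {R : realType} (P : probability Omega R).
Local Open Scope ereal_scope.

Lemma independent_of_pi_system (G : set_system Omega) (B : set Omega) :
  measurable B -> G `<=` measurable -> G setT -> setI_closed G ->
  (forall A, G A -> P (A `&` B) = P A * P B) ->
  forall A, <<s G >> A -> P (A `&` B) = P A * P B.
Proof.
move=> mB mG GT GI indG A GA.
have c0 : (0 <= fine (P B))%R by rewrite fine_ge0.
pose m1 : {measure set Omega -> \bar R} := mrestr P mB.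
pose m2 : {measure set Omega -> \bar R} := mscale (NngNum c0) P.
have m2E C : m2 C = P C * P B.
  by rewrite /m2/= /mscale/= muleC fineK// fin_num_measure.
rewrite -m2E; change (P (A `&` B)) with (m1 A).
apply: (g_sigma_algebra_measure_unique G mG (fun _ => setT)) => //.
- by rewrite bigcup_const//; exists 0%N.
- by move=> C GC; rewrite m2E; exact: indG.
- by move=> _; rewrite -ge0_fin_numE ?fin_num_measure.
Qed.

Context d1 d2 (T1 : measurableType d1) (T2 : measurableType d2).

(** Under independence the law of (U, Z) is a product, so that averaging over Z
    with U frozen computes a conditional expectation given U. *)
Lemma ge0_expectation_indep (U : {mfun Omega >-> T1}) (Z : {mfun Omega >-> T2})
    (Phi : T1 * T2 -> \bar R) :
  (forall A B, measurable A -> measurable B ->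
    P (U @^-1` A `&` Z @^-1` B) = P (U @^-1` A) * P (Z @^-1` B)) ->
  measurable_fun [set: T1 * T2] Phi -> (forall u, 0 <= Phi u) ->
  \int[P]_w Phi (U w, Z w) =
  \int[P]_w \int[distribution P Z]_z Phi (U w, z).
Proof.
move=> ind mPhi Phi0.
have mUZ : measurable_fun [set: Omega] (fun w => (U w, Z w)).
  exact: measurable_fun_pair.
pose UZ : {mfun Omega >-> (T1 * T2)%type} := mfun_Sub (mem_set mUZ).
transitivity (\int[distribution P UZ]_u Phi u).
  by rewrite ge0_integral_distribution.
transitivity (\int[distribution P U \x distribution P Z]_u Phi u).
  apply: eq_measure_integral => /= A mA _.
  by apply/esym; apply: product_measure_unique.
rewrite fubini_tonelli1// ge0_integral_distribution//.
- exact: measurable_fun_fubini_tonelli_F.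
- by move=> u; apply: integral_ge0.
Qed.

(** The positive and negative parts of D have the same integral in z for every u,
    hence the same expectation by [ge0_expectation_indep]. *)
Lemma expectation_indep_eq0 (U : {mfun Omega >-> T1}) (Z : {mfun Omega >-> T2})
    (D : T1 * T2 -> R) :
  (forall A B, measurable A -> measurable B ->
    P (U @^-1` A `&` Z @^-1` B) = P (U @^-1` A) * P (Z @^-1` B)) ->
  measurable_fun [set: T1 * T2] D ->
  P.-integrable [set: Omega] (EFin \o (fun w => D (U w, Z w))) ->
  (forall u,
    (distribution P Z).-integrable [set: T2] (EFin \o (fun z => D (u, z)))) ->
  (forall u, \int[distribution P Z]_z (D (u, z))%:E = 0) ->
  \int[P]_w (D (U w, Z w))%:E = 0.
Proof.
move=> ind mD iD iDu D0.
have mE : measurable_fun [set: T1 * T2] (EFin \o D) by exact/measurable_EFinP.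
pose ED := EFin \o D.
have pos_part : \int[P]_w ((ED \o (fun w => (U w, Z w)))^\+ w) =
    \int[P]_w ((ED \o (fun w => (U w, Z w)))^\- w).
  rewrite funepos_comp funeneg_comp.
  apply: (etrans (ge0_expectation_indep ind (measurable_funepos mE) _)).
    by move=> u; exact: funepos_ge0.
  apply: (etrans _ (esym (ge0_expectation_indep ind (measurable_funeneg mE) _))).
    apply: eq_integral => w _.
    pose ED_w := ED \o (fun z => (U w, z)).
    have EDw0 : \int[distribution P Z]_z (ED_w^\+ z) -
        \int[distribution P Z]_z (ED_w^\- z) = 0.
      by rewrite -integralE; exact: D0.
    have pos_fin := integrable_pos_fin_num measurableT (iDu (U w)).
    have neg_fin := integrable_neg_fin_num measurableT (iDu (U w)).
    have /eqP := EDw0; rewrite sube_eq ?fin_num_adde_defl// add0e => /eqP.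
    by rewrite /ED_w funepos_comp funeneg_comp.
  by move=> u; exact: funeneg_ge0.
rewrite -[LHS]/(\int[P]_w (ED \o (fun w => (U w, Z w))) w) integralE.
rewrite pos_part subee//; exact: (integrable_neg_fin_num measurableT iD).
Qed.

End independence_tonelli.

(** * Truncated moments and truncated exponential moments *)

Section real_integrable.
Context d (T : measurableType d) {R : realType} (mu : probability T R).
Implicit Types f g : T -> R.

Lemma integrable_EFinD f g :
  mu.-integrable [set: T] (EFin \o f) -> mu.-integrable [set: T] (EFin \o g) ->
  mu.-integrable [set: T] (EFin \o (fun t => f t + g t)).
Proof. by move=> mf mg; exact: (integrableD measurableT mf mg). Qed.

Lemma integrable_EFinB f g :
  mu.-integrable [set: T] (EFin \o f) -> mu.-integrable [set: T] (EFin \o g) ->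
  mu.-integrable [set: T] (EFin \o (fun t => f t - g t)).
Proof. by move=> mf mg; exact: (integrableB measurableT mf mg). Qed.

Lemma integrable_EFinZ f k : mu.-integrable [set: T] (EFin \o f) ->
  mu.-integrable [set: T] (EFin \o (fun t => k * f t)).
Proof. by move=> mf; exact: (integrableZl measurableT k mf). Qed.

Lemma integrable_EFin_normr f : mu.-integrable [set: T] (EFin \o f) ->
  mu.-integrable [set: T] (EFin \o (fun t => `|f t|)).
Proof. by move=> mf; exact: (integrable_abse mf). Qed.

Lemma integrable_EFin_cst k : mu.-integrable [set: T] (EFin \o (fun=> k)).
Proof. exact: (finite_measure_integrable_cst mu k measurableT). Qed.

Lemma integral_prob_cst k : (\int[mu]_t k%:E = k%:E)%E.
Proof.
rewrite integral_cst// -[RHS]mule1; congr (_ * _)%E; exact: probability_setT.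
Qed.

Lemma Rintegral_prob_cst k : \int[mu]_t k = k.
Proof. by rewrite /Rintegral integral_prob_cst. Qed.

Lemma integrable_EFin_norm_le f g : measurable_fun [set: T] f ->
  (forall t, `|f t| <= g t) -> mu.-integrable [set: T] (EFin \o g) ->
  mu.-integrable [set: T] (EFin \o f).
Proof.
move=> mf fg ig; apply: (le_integrable measurableT _ _ ig) => [|t _].
  exact/measurable_EFinP.
by rewrite lee_fin (le_trans (fg t))// ler_norm.
Qed.

End real_integrable.

Lemma measurable_le_natr d (T : measurableType d) (R : realType) (G : T -> R) y :
  measurable_fun [set: T] G ->
  measurable_fun [set: T] (fun t => (G t <= y)%R%:R : R).
Proof.
move=> mG; have -> : (fun t => (G t <= y)%R%:R) =
    (fun t => if (G t <= y)%R then 1 else 0) :> (T -> R).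
  by apply/funext => t; case: ifP.
by apply: measurable_fun_ifT => //; exact: measurable_fun_ler.
Qed.

Section truncated_moment.
Context d (T : measurableType d) {R : realType} (mu : probability T R).
Implicit Types (G D : T -> R) (p h y v : R).

Definition truncated_power p y (x : R) : R := (x <= y)%R%:R * (x / y) `^ p.

Lemma truncated_power_ge0 p y x : 0 <= truncated_power p y x.
Proof. by rewrite mulr_ge0 ?powR_ge0. Qed.

Lemma truncated_power_le1 p y x : 0 <= p -> 0 < y -> 0 <= x ->
  truncated_power p y x <= 1.
Proof.
move=> p0 y0 x0; rewrite /truncated_power.
have [xy|] := leP x y; last by rewrite mul0r.
rewrite mul1r -[leRHS]/((fun=> 1) p) -powR1.
by rewrite ge0_ler_powR ?nnegrE ?ler_pdivrMr ?mul1r// divr_ge0// ltW.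
Qed.

Lemma measurable_truncated_power p y :
  measurable_fun [set: R] (truncated_power p y).
Proof.
apply: measurable_funM.
  exact: (measurable_le_natr y (@measurable_id _ R setT)).
apply: (measurableT_comp (measurable_powR p)).
exact: measurable_funM.
Qed.

Lemma integrable_truncated_power p y G : 0 <= p -> 0 < y ->
  (forall t, 0 <= G t) -> measurable_fun [set: T] G ->
  mu.-integrable [set: T] (EFin \o (fun t => truncated_power p y (G t))).
Proof.
move=> p0 y0 G0 mG.
apply: (integrable_EFin_norm_le _ _ (integrable_EFin_cst mu 1)) => [|t].
  exact: (measurableT_comp (measurable_truncated_power p y)).
by rewrite ger0_norm ?truncated_power_ge0//; exact: truncated_power_le1.
Qed.

(** The power bounds 1 above y and is what gets truncated below: both terms fit in
    one full moment. *)
Lemma tail_add_truncated_moment_le p y G : 0 <= p -> 0 < y ->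
  (forall t, 0 <= G t) -> measurable_fun [set: T] G ->
  (mu [set t | (y < G t)%R] + \int[mu]_t (truncated_power p y (G t))%:E <=
   \int[mu]_t ((G t / y) `^ p)%:E)%E.
Proof.
move=> p0 y0 G0 mG.
have mA : measurable [set t | (y < G t)%R].
  rewrite -[X in measurable X]setTI (_ : [set t | _] = G @^-1` `]y, +oo[).
    exact: mG.
  by apply/seteqP; split => t /=; rewrite in_itv/= andbT.
have mp : measurable_fun [set: T] (fun t => (truncated_power p y (G t))%:E).
  apply/measurable_EFinP.
  exact: (measurableT_comp (measurable_truncated_power p y)).
have mi : measurable_fun [set: T]
    (fun t => (\1_[set t | (y < G t)%R] t)%:E : \bar R).
  by apply/measurable_EFinP; exact: measurable_indic.
rewrite -[X in (mu X + _)%E]setIT -integral_indic//.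
rewrite -ge0_integralD//=; last by move=> t _; rewrite lee_fin truncated_power_ge0.
apply: ge0_le_integral => //=.
- by move=> t _; rewrite adde_ge0// lee_fin ?truncated_power_ge0.
- exact: emeasurable_funD.
- apply/measurable_EFinP; apply: (measurableT_comp (measurable_powR p)).
  exact: measurable_funM.
move=> t _; rewrite -EFinD lee_fin /truncated_power indicE.
have [Gy|yG] := leP (G t) y.
  by rewrite memNset ?add0r ?mul1r//= => /lt_geF; rewrite Gy.
rewrite mem_set//= mul0r addr0.
rewrite -[leLHS]/((fun=> 1) p) -powR1.
have y_ge0 := ltW y0.
by rewrite ge0_ler_powR ?nnegrE ?divr_ge0// ler_pdivlMr// mul1r ltW.
Qed.

Lemma square_integrable G v : measurable_fun [set: T] G ->
  (\int[mu]_t (G t ^+ 2)%:E <= v%:E)%E ->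
  mu.-integrable [set: T] (EFin \o (fun t => G t ^+ 2)).
Proof.
move=> mG G2v; apply/integrableP; split.
  by apply/measurable_EFinP; exact: measurable_funX.
under eq_integral do rewrite /= ger0_norm ?sqr_ge0//.
exact: le_lt_trans G2v (ltry _).
Qed.

(** Because |D| <= G <= 1 + G^2. *)
Lemma integrable_of_square_moment D G v :
  measurable_fun [set: T] D -> measurable_fun [set: T] G ->
  (forall t, `|D t| <= G t) -> (\int[mu]_t (G t ^+ 2)%:E <= v%:E)%E ->
  mu.-integrable [set: T] (EFin \o D).
Proof.
move=> mD mG DG G2v; have iG2 := square_integrable mG G2v.
apply: (integrable_EFin_norm_le mD _
  (integrable_EFinD (integrable_EFin_cst mu 1) iG2)) => t.
apply: (le_trans (DG t)).
by have := sqr_ge0 (G t - 1); have := le_trans (normr_ge0 _) (DG t); nra.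
Qed.

(** [truncated_expR_le] integrated: the linear term disappears as D is centered,
    and 1 + z <= e^z turns the bound into a factor that multiplies along the
    martingale. *)
Lemma integral_truncated_expR_le p h y v G D : 0 < p -> 0 < h -> 0 < y ->
  measurable_fun [set: T] G -> measurable_fun [set: T] D ->
  (forall t, `|D t| <= G t) ->
  (\int[mu]_t (D t)%:E = 0)%E ->
  (\int[mu]_t (G t ^+ 2)%:E <= v%:E)%E ->
  (\int[mu]_t ((G t <= y)%R%:R * expR (h * D t))%:E <=
    (expR (expR p / 2 * h ^+ 2 * v +
      expR_excess p h y * \int[mu]_t truncated_power p y (G t))%R)%:E)%E.
Proof.
move=> p0 h0 y0 mG mD DG D0 G2v.
have G0 t : 0 <= G t by exact: le_trans (DG t).
have e0 := expR_ge0 p.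
have x0 := expR_excess_ge0 p h y.
set c := expR p / 2 * h ^+ 2; set x := expR_excess p h y.
have c0 : 0 <= c by rewrite mulr_ge0 ?sqr_ge0 ?divr_ge0.
have iG2 := square_integrable mG G2v.
have iD := integrable_of_square_moment mD mG DG G2v.
have iP := integrable_truncated_power (ltW p0) y0 G0 mG.
set tp := fun t => truncated_power p y (G t) in iP *.
have ihD := integrable_EFinZ h iD.
have i1 := integrable_EFinD (integrable_EFin_cst mu 1) ihD.
have i2 := integrable_EFinZ c iG2.
have i3 := integrable_EFinZ x iP.
have i12 := integrable_EFinD i1 i2.
apply: (@le_trans _ _ (\int[mu]_t (1 + h * D t + c * G t ^+ 2 + x * tp t)%:E)%E).
  have le12 t : (G t <= y)%R%:R * expR (h * D t) <=
     1 + h * D t + c * G t ^+ 2 + x * tp t by exact: truncated_expR_le.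
  apply: ge0_le_integral => //.
  - apply/measurable_EFinP; apply: measurable_funM; first exact: measurable_le_natr.
    by apply: (measurableT_comp (@measurable_expR R)); exact: measurable_funM.
  - by move/integrableP : (integrable_EFinD i12 i3) => [].
  - by move=> t _; rewrite lee_fin; exact: le12.
under eq_integral do rewrite EFinD.
rewrite integralD//.
under eq_integral do rewrite EFinD.
rewrite integralD//.
under eq_integral do rewrite EFinD EFinM.
rewrite integralD//; last exact: (integrable_EFin_cst mu 1).
rewrite integralZl// D0 mule0 adde0.
rewrite integral_prob_cst.
under eq_integral do rewrite EFinM.
rewrite integralZl//.
under [X in (_ + X)%E]eq_integral do rewrite EFinM.
rewrite integralZl//.
rewrite -[X in (x%:E * X)%E]fineK; last exact: (integrable_fin_num measurableT iP).
rewrite -/(Rintegral mu setT tp).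
apply: (@le_trans _ _ (1 + c%:E * v%:E + x%:E * (\int[mu]_t tp t)%R%:E)%E).
  by rewrite leeD2r// leeD2l// lee_wpmul2l.
rewrite -!EFinM -!EFinD lee_fin -addrA.
exact: expR_ge1Dx.
Qed.

End truncated_moment.

Section conditional_step.
Context d (Omega : measurableType d) {R : realType} (P : probability Omega R).
Context d1 d2 (T1 : measurableType d1) (T2 : measurableType d2).

(** One step of the exponential supermartingale: Q is the weight collected so far,
    and the new factor is bounded by a constant since the bound G on the
    increment depends on the fresh noise Z only. *)
Lemma expectation_truncated_expR_step (U : {mfun Omega >-> T1})
    (Z : {mfun Omega >-> T2}) (Q : T1 -> R) (D : T1 * T2 -> R) (G : T2 -> R)
    (p h y v : R) :
  (forall A B, measurable A -> measurable B ->
    P (U @^-1` A `&` Z @^-1` B) = (P (U @^-1` A) * P (Z @^-1` B))%E) ->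
  0 < p -> 0 < h -> 0 < y ->
  measurable_fun [set: T1] Q -> (forall u, 0 <= Q u) ->
  measurable_fun [set: T1 * T2] D -> measurable_fun [set: T2] G ->
  (forall u z, `|D (u, z)| <= G z) ->
  (forall u, \int[distribution P Z]_z (D (u, z))%:E = 0)%E ->
  (\int[P]_w (G (Z w) ^+ 2)%:E <= v%:E)%E ->
  (\int[P]_w (Q (U w) *
      ((G (Z w) <= y)%R%:R * expR (h * D (U w, Z w))))%:E <=
   (expR (expR p / 2 * h ^+ 2 * v + expR_excess p h y *
      \int[P]_w truncated_power p y (G (Z w)))%R)%:E *
   \int[P]_w (Q (U w))%:E)%E.
Proof.
move=> ind p0 h0 y0 mQ Q0 mD mG DG D0 G2v.
have G0 z : 0 <= G z by exact: le_trans (DG point z).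
set M := (expR _)%:E.
pose Phi (u : T1 * T2) : \bar R :=
  (Q u.1 * ((G u.2 <= y)%R%:R * expR (h * D u)))%:E.
have mPhi : measurable_fun [set: T1 * T2] Phi.
  apply/measurable_EFinP; apply: measurable_funM.
    exact: (measurableT_comp mQ).
  apply: measurable_funM.
    apply: measurable_le_natr; exact: (measurableT_comp mG).
  by apply: (measurableT_comp (@measurable_expR R)); exact: measurable_funM.
have Phi0 u : (0 <= Phi u)%E by rewrite lee_fin !mulr_ge0 ?expR_ge0.
rewrite -[leLHS]/(\int[P]_w Phi (U w, Z w))%E (ge0_expectation_indep ind)//.
have mtp : measurable_fun [set: T2] (fun z => (truncated_power p y (G z))%:E).
  apply/measurable_EFinP.
  exact: (measurableT_comp (measurable_truncated_power p y)).
have ME : M = (expR (expR p / 2 * h ^+ 2 * v + expR_excess p h y *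
      \int[distribution P Z]_z truncated_power p y (G z))%R)%:E.
  congr (expR (_ + _ * _))%:E; rewrite /Rintegral ge0_integral_distribution//.
  by move=> z; rewrite lee_fin truncated_power_ge0.
have mQU : measurable_fun [set: Omega] (fun w => (Q (U w))%:E).
  by apply/measurable_EFinP; exact: (measurableT_comp mQ).
rewrite -ge0_integralZl//; last 2 first.
  by move=> w _; rewrite lee_fin.
  by rewrite lee_fin expR_ge0.
apply: ge0_le_integral => //.
- by move=> w _; apply: integral_ge0.
- have := measurable_fun_fubini_tonelli_F (m2 := distribution P Z) Phi mPhi Phi0.
  by move=> mF; exact: (measurableT_comp mF).
- exact: measurable_funeM.
move=> w _; rewrite /Phi/=.
under eq_integral do rewrite EFinM.
have mD_w : measurable_fun [set: T2] (fun z => D (U w, z)).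
  by apply: (measurableT_comp mD); exact: measurable_pair1.
rewrite ge0_integralZl//=.
- rewrite muleC lee_wpmul2r ?lee_fin// ME.
  apply: integral_truncated_expR_le => //.
  rewrite ge0_integral_distribution//.
    by apply/measurable_EFinP; exact: measurable_funX.
  by move=> z; rewrite lee_fin sqr_ge0.
- apply/measurable_EFinP; apply: measurable_funM; first exact: measurable_le_natr.
  by apply: (measurableT_comp (@measurable_expR R)); exact: measurable_funM.
- by rewrite lee_fin.
Qed.

End conditional_step.

(** * The sigma-algebra of the past *)

Section past.
Context d (Omega : measurableType d) {R : realType} (P : probability Omega R).
Context d1 d2 (T1 : measurableType d1) (T2 : measurableType d2).
Variables (X1 : {RV P >-> T1}) (eps : nat -> {RV P >-> T2}).

(** A pi-system that generates the sigma-algebra of X_1, eps_2, ..., eps_m. *)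
Definition past_cylinders (m : nat) : set_system Omega :=
  [set A | exists A1 (B : nat -> set T2),
    [/\ measurable A1, forall i, measurable (B i) &
    A = X1 @^-1` A1 `&`
        \bigcap_(i in [set i | (2 <= i <= m)%N]) (eps i @^-1` B i)]].

Notation past m := (g_sigma_algebraType (past_cylinders m)).

Lemma past_cylindersT m : past_cylinders m setT.
Proof.
exists setT, (fun=> setT); split => //.
by rewrite preimage_setT setTI bigcapT.
Qed.

Lemma past_cylindersI m : setI_closed (past_cylinders m).
Proof.
move=> _ _ [A1 [B1 [mA1 mB1 ->]]] [A2 [B2 [mA2 mB2 ->]]].
exists (A1 `&` A2), (fun i => B1 i `&` B2 i); split.
- exact: measurableI.
- by move=> i; exact: measurableI.
- by rewrite setIACA preimage_setI -bigcapI.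
Qed.

Lemma past_cylinders_measurable m : past_cylinders m `<=` measurable.
Proof.
move=> _ [A1 [B1 [mA1 mB1 ->]]]; apply: measurableI.
  exact: measurable_funPTI.
by apply: bigcap_measurableType => k _; exact: measurable_funPTI.
Qed.

Lemma past_sub_measurable m : <<s past_cylinders m >> `<=` measurable.
Proof.
apply: smallest_sub; first exact: sigma_algebra_measurable.
exact: past_cylinders_measurable.
Qed.

Lemma measurable_past_id m : measurable_fun [set: Omega] (id : Omega -> past m).
Proof. by move=> _ A mA; rewrite setTI; exact: past_sub_measurable mA. Qed.

Lemma measurable_past_X1 m : measurable_fun [set: past m] (X1 : past m -> T1).
Proof.
move=> _ A mA; apply: sub_sigma_algebra; exists A, (fun=> setT); split => //.
by rewrite setTI bigcapT ?setIT.
Qed.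

Lemma measurable_past_eps m i : (2 <= i <= m)%N ->
  measurable_fun [set: past m] (eps i : past m -> T2).
Proof.
move=> im _ A mA; apply: sub_sigma_algebra.
exists setT, (fun j => if j == i then A else setT); split => //.
  by move=> j; case: ifP.
rewrite preimage_setT !setTI; apply/seteqP; split => [w wA j _ /=|w /(_ i im)/=].
  by case: eqP => // ->.
by rewrite eqxx.
Qed.

Hypothesis eps_indep : mutually_independent [set i | (1 <= i)%N] eps.
Hypothesis X1_indep : independent_systems P (g_sigma_algebra_preimage X1)
  (sigma_family [set i | (2 <= i)%N] eps).

(** Mutual independence is available for finite families of events: apply it to
    the indices 2..m and 2..m+1, and compare the two products. *)
Lemma eps_bigcap_indep m (B : nat -> set T2) C : (forall i, measurable (B i)) ->
  measurable C ->
  let W := \bigcap_(i in [set i | (2 <= i <= m)%N]) (eps i @^-1` B i) in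
  P (W `&` eps m.+1 @^-1` C) = (P W * P (eps m.+1 @^-1` C))%E.
Proof.
move=> mB mC W.
have [J JE] : exists J : {fset nat}, forall i, (i \in J) = (2 <= i <= m)%N.
  exists [fset i in iota 2 m.-1]%fset => i; rewrite !inE mem_iota.
  case: m {W} => [|m]/=; last by rewrite add2n.
  by case: i => [|[|i]].
have mJ : m.+1 \notin J by rewrite JE ltnn andbF.
pose B' i := if i == m.+1 then C else B i.
have mB' i : measurable (B' i) by rewrite /B'; case: ifP.
have WE : W = \bigcap_(i in [set` J]) (eps i @^-1` B' i).
  have B'E i : (i <= m)%N -> B' i = B i by move=> im; rewrite /B' ltn_eqF.
  apply/seteqP; split => w wW i /= => [|/[dup] im /andP[_ ?]].
    by rewrite JE => /[dup] im /andP[_ ?]; rewrite B'E//; exact: wW.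
  by have := wW i; rewrite /= JE B'E//; exact.
have J1 : [set` J] `<=` [set i | (1 <= i)%N].
  by move=> i /=; rewrite JE => /andP[/ltnW].
have mJ1 : [set` (m.+1 |` J)%fset] `<=` [set i | (1 <= i)%N].
  by move=> i /=; rewrite !inE JE => /orP[/eqP -> //|/andP[/ltnW]].
have WCE : W `&` eps m.+1 @^-1` C =
    \bigcap_(i in [set` (m.+1 |` J)%fset]) (eps i @^-1` B' i).
  rewrite WE; apply/seteqP; split => [w [wJ wC] i /=|w wJ].
    rewrite !inE => /orP[/eqP ->|iJ]; first by rewrite /B' eqxx.
    exact: wJ.
  split => [i iJ|]; first by apply: wJ; rewrite /= !inE iJ orbT.
  by have := wJ m.+1; rewrite /= !inE /B' eqxx; exact.
rewrite WCE (eps_indep mJ1 mB') big_fsetU1//= -(eps_indep J1 mB') -WE muleC.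
by rewrite /B' eqxx.
Qed.

(** On cylinders, split off X_1, which is independent of all later noises, and
    apply [eps_bigcap_indep]; the extension to the generated sigma-algebra is
    [independent_of_pi_system]. *)
Lemma past_indep m A C : (0 < m)%N -> <<s past_cylinders m >> A -> measurable C ->
  P (A `&` eps m.+1 @^-1` C) = (P A * P (eps m.+1 @^-1` C))%E.
Proof.
move=> m0 sA mC.
have mepsC : measurable (eps m.+1 @^-1` C) by exact: measurable_funPTI.
apply: (independent_of_pi_system mepsC _ _ _ _ sA).
- exact: past_cylinders_measurable.
- exact: past_cylindersT.
- exact: past_cylindersI.
move=> _ [A1 [B [mA1 mB ->]]].
set W := \bigcap_(i in _) _.
have sX1 : g_sigma_algebra_preimage X1 (X1 @^-1` A1) by exists A1; rewrite ?setTI.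
pose S := sigma_family [set i | (2 <= i)%N] eps.
have S_eps i D : (2 <= i)%N -> measurable D -> S (eps i @^-1` D).
  move=> i2 mD; apply: sub_sigma_algebra; exists i => //.
  by exists D; rewrite ?setTI.
have SW : S W.
  apply: (@bigcap_measurableType _ (g_sigma_algebraType
    (\bigcup_(i in [set i | (2 <= i)%N]) g_sigma_algebra_preimage (eps i)))).
  by move=> i /andP[i2 _]; exact: S_eps.
have SWC : S (W `&` eps m.+1 @^-1` C).
  apply: (@measurableI _ (g_sigma_algebraType
    (\bigcup_(i in [set i | (2 <= i)%N]) g_sigma_algebra_preimage (eps i)))) => //.
  exact: S_eps.
rewrite -setIA X1_indep// eps_bigcap_indep// X1_indep//.
by rewrite muleA.
Qed.

End past.

(** * Integrals of Lipschitz functions *)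

Section lipschitz_integral.
Context {R : realType} (T : completeMetricType R).
Hypothesis sepT : separable_space T.
Variable nu : probability (borel T) R.
Hypothesis int_mdist : forall x : T,
  nu.-integrable [set: borel T] (EFin \o (mdist x : borel T -> R)).
Variables (h : T -> R) (L : R).
Hypothesis L0 : 0 <= L.
Hypothesis h_lip : forall x x', `|h x - h x'| <= L * mdist x x'.

Lemma measurable_lipschitz : measurable_fun [set: borel T] (h : borel T -> R).
Proof.
apply: (@measurable_lipschitz_comp _ _ sepT _ (borel T) 1 (fun=> id)
  (fun x => h (x 0%N)) L) => // x x'.
by rewrite big_ord1.
Qed.

Lemma integrable_lipschitz :
  nu.-integrable [set: borel T] (EFin \o (h : borel T -> R)).
Proof.
apply: (integrable_EFin_norm_le measurable_lipschitz _
  (integrable_EFinD (integrable_EFin_cst nu `|h point|)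
    (integrable_EFinZ L (int_mdist point)))) => x.
have := h_lip x point; rewrite metric_sym.
have := ler_normB (h x - h point) (- h point); rewrite opprK subrK normrN; lra.
Qed.

(** How the mean distance to an independent copy comes to bound the increments of
    a martingale. *)
Lemma lipschitz_sub_integral_le x :
  `|h x - \int[nu]_x' h x'| <= L * \int[nu]_x' mdist x x'.
Proof.
have hi := integrable_lipschitz.
have ci := integrable_EFin_cst nu (h x).
have -> : h x = \int[nu]_x' h x by rewrite Rintegral_prob_cst.
rewrite -RintegralB// -RintegralZl//.
have bi := integrable_EFinB ci hi.
apply: (le_trans (le_normr_Rintegral measurableT bi)).
apply: le_Rintegral => //.
- exact: (integrable_EFin_normr bi).
- exact: (integrable_EFinZ L (int_mdist x)).
Qed.

End lipschitz_integral.

Lemma measurable_mean_dist (R : realType) (T : completeMetricType R)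
    (nu : probability (borel T) R) : separable_space T ->
  (forall x : T,
    nu.-integrable [set: borel T] (EFin \o (mdist x : borel T -> R))) ->
  measurable_fun [set: borel T]
    ((fun x => \int[nu]_x' mdist x x') : borel T -> R).
Proof.
move=> sepT int_d; apply: (measurable_lipschitz sepT (L := 1)) => // x x'.
rewrite mul1r -RintegralB//.
have bi := integrable_EFinB (int_d x) (int_d x').
apply: (le_trans (le_normr_Rintegral measurableT bi)).
rewrite -[leRHS](Rintegral_prob_cst nu).
apply: le_Rintegral => //.
- exact: (integrable_EFin_normr bi).
- exact: integrable_EFin_cst.
move=> z _; rewrite ler_norml; apply/andP; split.
  by have := metric_triangle x' x z; rewrite (metric_sym x' x); lra.
by have := metric_triangle x x' z; lra.
Qed.

Lemma mdist_comp_lip (R : realType) (E Y : completeMetricType R)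
    (g g' : Y -> E) (C : R) :
  (forall y y', mdist (g y) (g y') <= C * mdist y y') ->
  (forall y y', mdist (g' y) (g' y') <= C * mdist y y') ->
  forall y y', `|mdist (g y) (g' y) - mdist (g y') (g' y')| <=
    (C + C) * mdist y y'.
Proof.
move=> g_lip g'_lip y y'; have := g_lip y y'; have := g'_lip y y'.
have := metric_triangle (g y) (g y') (g' y).
have := metric_triangle (g y') (g' y') (g' y).
have := metric_triangle (g y') (g y) (g' y').
have := metric_triangle (g y) (g' y) (g' y').
rewrite (metric_sym (g y') (g y)) (metric_sym (g' y') (g' y)).
by move=> *; rewrite ler_norml mulrDl; apply/andP; split; lra.
Qed.

(** * The Doob martingale as functions of the path *)

Section doob_functions.
Context {R : realType} (E Y : completeMetricType R).
Hypotheses (sepE : separable_space E) (sepY : separable_space Y).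
Variable mu : probability (borel Y) R.
Hypothesis int_mdist : forall y : Y,
  mu.-integrable [set: borel Y] (EFin \o (mdist y : borel Y -> R)).
Variables (F : E -> Y -> E) (rho C : R).
Hypotheses (rho0 : 0 <= rho) (C0 : 0 <= C).
Hypothesis F_contr : forall x x',
  (\int[mu]_y (mdist (F x y) (F x' y))%:E <= (rho * mdist x x')%:E)%E.
Hypothesis F_lip : forall x y y', mdist (F x y) (F x y') <= C * mdist y y'.
Variables (N : nat) (phi : (nat -> E) -> R).

(** Paths are sequences indexed from 0, so that the k-th entry stands for X_(k+1).
    Functions of the first k+1 states are functions of the whole sequence whose
    Lipschitz bound [mdist_upto] ignores the later entries. *)
Definition upd (x : nat -> E) (k : nat) (z : E) : nat -> E :=
  fun i => if i == k then z else x i.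

Definition mdist_upto (k : nat) (c : R) (x x' : nat -> E) : R :=
  \sum_(i < k) mdist (x i) (x' i) + c * mdist (x k) (x' k).

Hypothesis phi_lip : forall x x', `|phi x - phi x'| <= mdist_upto N 1 x x'.

(** The functional phi with its last j noises integrated out. The state N - j' is
    resampled from its predecessor; j counts backwards from N, and only j <= N
    is meaningful. *)
Fixpoint doob_rec (j : nat) : (nat -> E) -> R :=
  if j is j'.+1 then
    fun x => \int[mu]_y doob_rec j' (upd x (N - j') (F (x (N - j').-1) y))
  else phi.

Definition doob (k : nat) := doob_rec (N - k).

Lemma doobN : doob N = phi. Proof. by rewrite /doob subnn. Qed.

Lemma doobS k x : (k < N)%N ->
  doob k x = \int[mu]_y doob k.+1 (upd x k.+1 (F (x k) y)).
Proof.
move=> kN; rewrite /doob -[(N - k)%N](subnSK kN)/=.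
by rewrite subKn.
Qed.

Lemma Kgeom0 : Kgeom rho 0 = 1.
Proof. by rewrite /Kgeom big_nat1 expr0. Qed.

Lemma KgeomS k : Kgeom rho k.+1 = 1 + rho * Kgeom rho k.
Proof.
rewrite /Kgeom big_nat_recl// expr0; congr (_ + _).
by rewrite mulr_sumr; apply: eq_bigr => i _; rewrite exprS.
Qed.

Lemma Kgeom_ge1 k : 1 <= Kgeom rho k.
Proof.
elim: k => [|k IH]; first by rewrite Kgeom0.
by rewrite KgeomS lerDl mulr_ge0// (le_trans _ IH).
Qed.

Lemma Kgeom_ge0 k : 0 <= Kgeom rho k.
Proof. exact: le_trans (Kgeom_ge1 k). Qed.

Lemma mdist_upto_upd k c x x' z z' :
  mdist_upto k c (upd x k z) (upd x' k z') =
  \sum_(i < k) mdist (x i) (x' i) + c * mdist z z'.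
Proof.
rewrite /mdist_upto /upd eqxx; congr (_ + _).
by apply: eq_bigr => i _; rewrite ltn_eqF.
Qed.

Lemma mdist_upto_upd_eq k c x z z' :
  mdist_upto k c (upd x k z) (upd x k z') = c * mdist z z'.
Proof.
by rewrite mdist_upto_upd big1 ?add0r// => i _; rewrite mdistxx.
Qed.

Section lipschitz_step.
Variables (k : nat) (g : (nat -> E) -> R) (c : R).
Hypotheses (c0 : 0 <= c)
  (g_lip : forall x x', `|g x - g x'| <= mdist_upto k c x x').

(** A Lipschitz function of the new state is Lipschitz in the noise. *)
Lemma noise_lipschitz x z y y' :
  `|g (upd x k (F z y)) - g (upd x k (F z y'))| <= c * C * mdist y y'.
Proof.
apply: (le_trans (g_lip _ _)).
by rewrite mdist_upto_upd_eq -mulrA ler_wpM2l.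
Qed.

Lemma integrable_noise x z : mu.-integrable [set: borel Y]
  (EFin \o ((fun y => g (upd x k (F z y))) : borel Y -> R)).
Proof.
apply: (integrable_lipschitz sepY int_mdist (L := c * C)).
  exact: mulr_ge0.
exact: noise_lipschitz.
Qed.

End lipschitz_step.

Lemma F_contr_Rintegral x x' :
  mu.-integrable [set: borel Y]
    (EFin \o ((fun y => mdist (F x y) (F x' y)) : borel Y -> R)) /\
  \int[mu]_y mdist (F x y) (F x' y) <= rho * mdist x x'.
Proof.
have int_d : mu.-integrable [set: borel Y]
    (EFin \o ((fun y => mdist (F x y) (F x' y)) : borel Y -> R)).
  apply: (integrable_lipschitz sepY int_mdist (L := C + C)).
    exact: addr_ge0.
  exact: mdist_comp_lip.
split=> //; rewrite -lee_fin /Rintegral fineK//.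
exact: (integrable_fin_num measurableT int_d).
Qed.

(** Moving the last known state by r changes phi directly by at most r, and
    through the next state, which moves by at most rho r in mean; so a constant
    K_j for the next function gives 1 + rho K_j = K_(j+1) for this one. *)
Lemma doob_lip k : (k <= N)%N -> forall x x',
  `|doob k x - doob k x'| <= mdist_upto k (Kgeom rho (N - k)) x x'.
Proof.
move=> kN; rewrite -(subKn kN); move: (N - k)%N (leq_subr k N) => {k kN} j.
elim: j => [|j IH] jN x x'; first by rewrite subn0 doobN subnn Kgeom0.
have kN : (N - j.+1 < N)%N by rewrite ltn_subrL (leq_trans _ jN).
rewrite !doobS//; move: IH => /(_ (ltnW jN)).
rewrite (subKn jN) (subKn (ltnW jN)) -(subnSK jN).
set k := (N - j.+1)%N; set K := Kgeom rho j => IH.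
have K0 : 0 <= K := Kgeom_ge0 j.
have ix := integrable_noise K0 IH x (x k).
have ix' := integrable_noise K0 IH x' (x' k).
have [int_d le_d] := F_contr_Rintegral (x k) (x' k).
have ci := integrable_EFin_cst mu (\sum_(i < k.+1) mdist (x i) (x' i)).
rewrite -RintegralB//.
have bi := integrable_EFinB ix ix'.
apply: (le_trans (le_normr_Rintegral measurableT bi)).
apply: (@le_trans _ _ (\int[mu]_y (\sum_(i < k.+1) mdist (x i) (x' i) +
    K * mdist (F (x k) y) (F (x' k) y)))).
  apply: le_Rintegral => //.
  - exact: (integrable_EFin_normr bi).
  - exact: (integrable_EFinD ci (integrable_EFinZ K int_d)).
  move=> y _; apply: (le_trans (IH _ _)).
  by rewrite mdist_upto_upd.
rewrite RintegralD//; last exact: (integrable_EFinZ K int_d).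
rewrite Rintegral_prob_cst RintegralZl// /mdist_upto big_ord_recr/= KgeomS.
have := ler_wpM2l K0 le_d; rewrite -/K; lra.
Qed.

(** The increment compares one value of the noise with its average, so
    [lipschitz_sub_integral_le] applies to the noise. *)
Lemma doob_increment_le k x y : (k < N)%N ->
  `|doob k.+1 (upd x k.+1 (F (x k) y)) - doob k x| <=
  Kgeom rho (N - k.+1) * (C * \int[mu]_y' mdist y y').
Proof.
move=> kN; rewrite (doobS _ kN) mulrA.
have K0 := Kgeom_ge0 (N - k.+1).
apply: (lipschitz_sub_integral_le sepY int_mdist (mulr_ge0 K0 C0)
  (h := fun y => doob k.+1 (upd x k.+1 (F (x k) y)))).
exact: (noise_lipschitz K0 (doob_lip kN)).
Qed.

Lemma doob_increment_integral k x : (k < N)%N ->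
  mu.-integrable [set: borel Y]
    (EFin \o (fun y : borel Y =>
      doob k.+1 (upd x k.+1 (F (x k) y)) - doob k x)) /\
  (\int[mu]_y (doob k.+1 (upd x k.+1 (F (x k) y)) - doob k x)%:E = 0)%E.
Proof.
move=> kN; have K0 := Kgeom_ge0 (N - k.+1).
have i1 := integrable_noise K0 (doob_lip kN) x (x k).
have i2 := integrable_EFin_cst mu (doob k x).
have iB := integrable_EFinB i1 i2; split=> //.
rewrite -[LHS]fineK; last exact: (integrable_fin_num measurableT iB).
rewrite -[X in X%:E]/(\int[mu]_y (doob k.+1 (upd x k.+1 (F (x k) y)) - doob k x)).
rewrite RintegralB// Rintegral_prob_cst -doobS//.
by rewrite subrr.
Qed.

Lemma measurable_doob d (T : measurableType d) (Z : nat -> T -> borel E) k :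
  (k <= N)%N -> (forall i, (i <= k)%N -> measurable_fun [set: T] (Z i)) ->
  measurable_fun [set: T] (fun t => doob k (fun i => Z i t)).
Proof.
move=> kN mZ.
apply: (measurable_lipschitz_comp sepE (n := k.+1) (c := Kgeom rho (N - k))) => //.
  exact: Kgeom_ge0.
move=> x x'; apply: (le_trans (doob_lip kN _ _)).
rewrite /mdist_upto big_ord_recr/= mulrDr lerD2r ler_peMl ?Kgeom_ge1//.
by apply: sumr_ge0 => i _; exact: mdist_ge0.
Qed.

End doob_functions.

(** * The deviation inequality for the chain *)

Section chain.
Context {R : realType} (E Y : completeMetricType R).
Hypotheses (sepE : separable_space E) (sepY : separable_space Y).
Context d (Omega : measurableType d) (P : probability Omega R).
Variables (eps : nat -> {RV P >-> borel Y}) (X : nat -> {RV P >-> borel E}).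
Hypothesis iid_eps : iid [set i | (1 <= i)%N] eps.
Hypothesis indep_X1 : independent_systems P
  (g_sigma_algebra_preimage (X 1%N)) (sigma_family [set i | (2 <= i)%N] eps).
Variable F : E -> Y -> E.
Hypothesis mF : measurable_fun [set: borel E * borel Y]
  (fun z : borel E * borel Y => (F z.1 z.2 : borel E)).
Hypothesis chain : forall (k : nat) (w : Omega), (2 <= k)%N ->
  X k w = F (X k.-1 w) (eps k w).
Variables (rho C : R).
Hypotheses (rho0 : 0 <= rho) (C0 : 0 <= C).

Let mu := distribution P (eps 1%N).
Let nu := distribution P (X 1%N).

Hypothesis F_contr : forall x x' : E,
  (\int[mu]_y (mdist (F x y) (F x' y))%:E <= (rho * mdist x x')%:E)%E.
Hypothesis F_lip : forall (x : E) (y y' : Y),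
  mdist (F x y) (F x y') <= C * mdist y y'.
Hypothesis int_eps : forall y : Y,
  mu.-integrable [set: borel Y] (EFin \o (mdist y : borel Y -> R)).
Hypothesis int_X1 : forall x : E,
  nu.-integrable [set: borel E] (EFin \o (mdist x : borel E -> R)).

Lemma eps_law k (h : borel Y -> \bar R) : (1 <= k)%N ->
  (\int[distribution P (eps k)]_y h y = \int[mu]_y h y)%E.
Proof.
move=> k1; apply: eq_measure_integral => A mA _ /=.
by case: iid_eps => _; apply.
Qed.

(** The functions G_X1 and G_eps, with real values. *)
Definition mean_dist_X1 (x : E) : R := \int[nu]_x' mdist x x'.
Definition mean_dist_eps (y : Y) : R := C * \int[mu]_y' mdist y y'.

Lemma measurable_mean_dist_X1 :
  measurable_fun [set: borel E] (mean_dist_X1 : borel E -> R).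
Proof. exact: measurable_mean_dist. Qed.

Lemma measurable_mean_dist_eps :
  measurable_fun [set: borel Y] (mean_dist_eps : borel Y -> R).
Proof. by apply: measurable_funM => //; exact: measurable_mean_dist. Qed.

Variable N : nat.

(** The bounds Gamma_(k+1) on the increments: step 0 reveals X_1, and step k >= 1
    reveals eps_(k+1). *)
Definition dominating (k : nat) (w : Omega) : R :=
  if k is k'.+1 then Kgeom rho (N - k) * mean_dist_eps (eps k.+1 w)
  else Kgeom rho N * mean_dist_X1 (X 1%N w).

Lemma dominating_ge0 k w : 0 <= dominating k w.
Proof.
case: k => [|k]/=; rewrite mulr_ge0 ?Kgeom_ge0//.
  by apply: Rintegral_ge0 => x _; exact: mdist_ge0.
by rewrite mulr_ge0//; apply: Rintegral_ge0 => x _; exact: mdist_ge0.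
Qed.

Lemma measurable_dominating k : measurable_fun [set: Omega] (dominating k).
Proof.
case: k => [|k]; apply: measurable_funM => //.
  exact: (measurableT_comp measurable_mean_dist_X1).
exact: (measurableT_comp measurable_mean_dist_eps).
Qed.

Variables (V1 V2 : R).
Hypothesis moment2_X1 :
  (\int[P]_w (mean_dist_X1 (X 1%N w) ^+ 2)%:E <= V1%:E)%E.
Hypothesis moment2_eps :
  (\int[P]_w (mean_dist_eps (eps 1%N w) ^+ 2)%:E <= V2%:E)%E.

Definition variance_bound (k : nat) : R :=
  if k is k'.+1 then V2 * Kgeom rho (N - k) ^+ 2 else V1 * Kgeom rho N ^+ 2.

Lemma eps_expectation k (h : borel Y -> \bar R) : (1 <= k)%N ->
  measurable_fun [set: borel Y] h -> (forall y, 0 <= h y)%E ->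
  (\int[P]_w h (eps k w) = \int[P]_w h (eps 1%N w))%E.
Proof.
move=> k1 mh h0.
rewrite -[LHS](ge0_integral_distribution (eps k) mh h0).
by rewrite -[RHS](ge0_integral_distribution (eps 1%N) mh h0) eps_law.
Qed.

Lemma dominating_moment2 k :
  (\int[P]_w (dominating k w ^+ 2)%:E <= (variance_bound k)%:E)%E.
Proof.
have scale (c v : R) (h : Omega -> R) : measurable_fun [set: Omega] h ->
    (\int[P]_w (h w ^+ 2)%:E <= v%:E)%E ->
    (\int[P]_w ((c * h w) ^+ 2)%:E <= (v * c ^+ 2)%:E)%E.
  move=> mh hv; under eq_integral do rewrite exprMn EFinM.
  rewrite ge0_integralZl//=.
  - by rewrite (mulrC v) [leRHS]EFinM lee_wpmul2l// lee_fin sqr_ge0.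
  - by apply/measurable_EFinP; exact: measurable_funX.
  - by move=> w _; rewrite lee_fin sqr_ge0.
  - by rewrite lee_fin sqr_ge0.
case: k => [|k].
  apply: scale; last exact: moment2_X1.
  exact: (measurableT_comp measurable_mean_dist_X1).
apply: scale; first exact: (measurableT_comp measurable_mean_dist_eps).
rewrite (eps_expectation (h := fun y => (mean_dist_eps y ^+ 2)%:E))//.
  apply/measurable_EFinP; apply: measurable_funX.
  exact: measurable_mean_dist_eps.
by move=> y; rewrite lee_fin sqr_ge0.
Qed.

Notation past m := (g_sigma_algebraType (past_cylinders (X 1%N) eps m)).

Lemma past_measurable_X m i : (1 <= i <= m)%N ->
  measurable_fun [set: past m] (X i : past m -> borel E).
Proof.
elim: i => // i IH /andP[_ im].
have [->|i0] := posnP i; first exact: measurable_past_X1.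
have -> : X i.+1 = (fun w => F (X i w) (eps i.+1 w)) :> (Omega -> E).
  by apply/funext => w; rewrite chain.
have mp : measurable_fun [set: past m] (fun w : past m => (X i w, eps i.+1 w)).
  apply: measurable_fun_pair; first by apply: IH; rewrite i0 ltnW.
  by apply: measurable_past_eps; rewrite ltnS i0.
exact: (measurableT_comp mF mp).
Qed.

Section functional.
Variable phi : (nat -> E) -> R.
Hypothesis phi_lip : forall x x', `|phi x - phi x'| <= mdist_upto N 1 x x'.

Let M := doob mu F N phi.
Let path (w : Omega) : nat -> E := fun i => X i.+1 w.

Let m0 : R := \int[nu]_x M 0 (fun=> x).

(** Replacing a state by what the recursion makes of its predecessor does nothing
    on an actual trajectory: this turns the functions [doob] into a martingale
    along the chain. *)
Lemma path_upd k w : upd (path w) k.+1 (F (path w k) (eps k.+2 w)) = path w.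
Proof.
apply/funext => i; rewrite /upd /path; case: eqP => // ->.
by rewrite (chain w (isT : (2 <= k.+2)%N)).
Qed.

Lemma M0_lip x x' : `|M 0 (fun=> x) - M 0 (fun=> x')| <= Kgeom rho N * mdist x x'.
Proof.
have := doob_lip sepY int_eps rho0 C0 F_contr F_lip phi_lip (leq0n N).
by move=> /(_ (fun=> x) (fun=> x')); rewrite /mdist_upto big_ord0 add0r subn0.
Qed.

Lemma M0E w : M 0 (path w) = M 0 (fun=> X 1%N w).
Proof.
have := doob_lip sepY int_eps rho0 C0 F_contr F_lip phi_lip (leq0n N).
move=> /(_ (path w) (fun=> X 1%N w)).
rewrite /mdist_upto big_ord0 add0r /path mdistxx mulr0 normr_le0 subr_eq0.
by move=> /eqP.
Qed.

Lemma initial_increment_le w : `|M 0 (path w) - m0| <= dominating 0 w.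
Proof.
rewrite M0E; exact: (lipschitz_sub_integral_le sepE int_X1 (Kgeom_ge0 rho0 N)
  (h := fun x => M 0 (fun=> x)) M0_lip).
Qed.

Lemma increment_le k w : (k < N)%N ->
  `|M k.+1 (path w) - M k (path w)| <= dominating k.+1 w.
Proof.
move=> kN; rewrite -{1}(path_upd k w).
exact: (doob_increment_le sepY int_eps rho0 C0 F_contr F_lip phi_lip).
Qed.

Lemma measurable_M k : (k <= N)%N ->
  measurable_fun [set: Omega] (fun w => M k (path w)).
Proof.
move=> kN.
exact: (measurable_doob sepE sepY int_eps rho0 C0 F_contr F_lip phi_lip kN
  (Z := fun i => X i.+1)).
Qed.

Lemma integrable_M0 : P.-integrable [set: Omega] (EFin \o (fun w => M 0 (path w))).
Proof.
have mB : measurable_fun [set: Omega] (fun w => M 0 (path w) - m0).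
  by apply: measurable_funB => //; exact: measurable_M.
have iB := integrable_of_square_moment mB (measurable_dominating 0)
  initial_increment_le (dominating_moment2 0).
have := integrable_EFinD iB (integrable_EFin_cst P m0).
by congr (_.-integrable _ _); apply/funext => w /=; rewrite subrK.
Qed.

Lemma expectation_initial_increment :
  (\int[P]_w (M 0 (path w) - m0)%:E = 0)%E.
Proof.
have hi := integrable_lipschitz sepE int_X1 (Kgeom_ge0 rho0 N) M0_lip.
have mh := measurable_lipschitz sepE (Kgeom_ge0 rho0 N) M0_lip.
under eq_integral do rewrite M0E EFinB.
have iM0 : P.-integrable [set: Omega] (EFin \o (fun w => M 0 (fun=> X 1%N w))).
  have := integrable_M0; congr (_.-integrable _ _).
  by apply/funext => w /=; rewrite M0E.
have cst_m0 := integrable_EFin_cst P m0.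
rewrite integralB//.
rewrite -[X in (X - _)%E]/(\int[P]_w ((EFin \o (fun x : borel E => M 0 (fun=> x)))
   \o X 1%N) w)%E.
rewrite -integral_distribution//; last exact/measurable_EFinP.
rewrite integral_prob_cst.
rewrite -[X in (X - _)%E]fineK; last exact: (integrable_fin_num measurableT hi).
by rewrite -EFinB subrr.
Qed.

Lemma past_measurable_M k m : (k <= N)%N -> (k < m)%N ->
  measurable_fun [set: past m] ((fun w => M k (path w)) : past m -> R).
Proof.
move=> kN km.
apply: (measurable_doob sepE sepY int_eps rho0 C0 F_contr F_lip phi_lip kN
  (Z := fun i => (X i.+1 : past m -> borel E))) => i ik.
by apply: past_measurable_X; rewrite /= (leq_trans _ km).
Qed.

Lemma past_measurable_dominating k m : (k < m)%N ->
  measurable_fun [set: past m] (dominating k : past m -> R).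
Proof.
case: k => [|k] km; apply: measurable_funM => //.
  apply: (measurableT_comp measurable_mean_dist_X1).
  exact: measurable_past_X1.
apply: (measurableT_comp measurable_mean_dist_eps).
exact: measurable_past_eps.
Qed.

Let past_id m : {mfun Omega >-> past m} :=
  mfun_Sub (mem_set (measurable_past_id (X1 := X 1%N) (eps := eps) (m := m))).

(** The increment as a function of the past and of a free value of the noise. *)
Let D k (u : past k.+1 * borel Y) : R :=
  M k.+1 (upd (path u.1) k.+1 (F (path u.1 k) u.2)) - M k (path u.1).

Lemma measurable_D k : (k < N)%N ->
  measurable_fun [set: past k.+1 * borel Y] (@D k).
Proof.
move=> kN; apply: measurable_funB; last first.
  apply: (measurableT_comp (past_measurable_M (ltnW kN) (ltnSn k))).
  exact: measurable_fst.
apply: (measurable_doob sepE sepY int_eps rho0 C0 F_contr F_lip phi_lip kN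
  (Z := fun i (u : past k.+1 * borel Y) =>
    upd (path u.1) k.+1 (F (path u.1 k) u.2) i)) => i ik.
rewrite /upd /path; have [_|ik1] := eqVneq i k.+1.
  have mX : measurable_fun [set: past k.+1 * borel Y]
      (fun u : past k.+1 * borel Y => (X k.+1 u.1 : borel E, u.2)).
    apply: measurable_fun_pair; last exact: measurable_snd.
    apply: (measurableT_comp (past_measurable_X (m := k.+1) (i := k.+1) _)).
      by rewrite /= leqnn.
    exact: measurable_fst.
  exact: (measurableT_comp mF mX).
apply: (measurableT_comp (past_measurable_X (m := k.+1) (i := i.+1) _)).
  by rewrite /= ltn_neqAle ik1.
exact: measurable_fst.
Qed.

Lemma DE k w : D (past_id k.+1 w, eps k.+2 w) = M k.+1 (path w) - M k (path w).
Proof. by rewrite /D /= path_upd. Qed.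

Lemma past_eps_indep k A B : measurable A -> measurable B ->
  P (past_id k.+1 @^-1` A `&` eps k.+2 @^-1` B) =
  (P (past_id k.+1 @^-1` A) * P (eps k.+2 @^-1` B))%E.
Proof.
move=> mA mB.
exact: (past_indep (proj1 iid_eps) indep_X1 (ltn0Sn k) mA mB).
Qed.

Lemma D_integral k (u : past k.+1) : (k < N)%N ->
  (distribution P (eps k.+2)).-integrable [set: borel Y]
    (EFin \o (fun y => D (u, y))) /\
  (\int[distribution P (eps k.+2)]_y (D (u, y))%:E = 0)%E.
Proof.
move=> kN.
have [iD D0] := doob_increment_integral sepY int_eps rho0 C0 F_contr F_lip
  phi_lip (path u) kN.
have /integrableP[mD D_lt] := iD.
split; last by rewrite eps_law.
by apply/integrableP; split => //; rewrite eps_law.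
Qed.

Lemma integrable_increment k : (k < N)%N ->
  P.-integrable [set: Omega] (EFin \o (fun w => M k.+1 (path w) - M k (path w))).
Proof.
move=> kN.
have mB : measurable_fun [set: Omega] (fun w => M k.+1 (path w) - M k (path w)).
  by apply: measurable_funB; apply: measurable_M => //; exact: ltnW.
exact: (integrable_of_square_moment mB (measurable_dominating k.+1)
  (fun w => increment_le w kN) (dominating_moment2 k.+1)).
Qed.

Lemma expectation_increment k : (k < N)%N ->
  (\int[P]_w (M k.+1 (path w) - M k (path w))%:E = 0)%E.
Proof.
move=> kN; under eq_integral do rewrite -DE.
apply: (expectation_indep_eq0 (U := past_id k.+1) (Z := eps k.+2)).
- exact: past_eps_indep.
- exact: measurable_D.
- have := integrable_increment kN; congr (_.-integrable _ _).
  by apply/funext => w; rewrite /= -DE.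
- by move=> u; case: (D_integral u kN).
- by move=> u; case: (D_integral u kN).
Qed.

Lemma expectation_M k : (k <= N)%N ->
  P.-integrable [set: Omega] (EFin \o (fun w => M k (path w))) /\
  (\int[P]_w (M k (path w))%:E = m0%:E)%E.
Proof.
elim: k => [_|k IH kN].
  split; first exact: integrable_M0.
  have := expectation_initial_increment; under eq_integral do rewrite EFinB.
  have i0 := integrable_M0; have ic := integrable_EFin_cst P m0.
  rewrite integralB// integral_prob_cst.
  have := integrable_fin_num measurableT i0; rewrite /comp => f0.
  by move/eqP; rewrite sube_eq ?fin_num_adde_defl// add0e => /eqP.
have [i0 E0] := IH (ltnW kN).
have i1 := integrable_increment kN; have E1 := expectation_increment kN.
have MS w : M k.+1 (path w) = M k (path w) + (M k.+1 (path w) - M k (path w)).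
  by rewrite addrC subrK.
split.
  have := integrable_EFinD i0 i1; congr (_.-integrable _ _).
  by apply/funext => w; rewrite /= -MS.
under eq_integral do rewrite MS EFinD.
by rewrite integralD// E0 E1 adde0.
Qed.

Section chernoff.
Variables (p h y : R).
Hypotheses (p0 : 0 < p) (h0 : 0 < h) (y0 : 0 < y).

Definition truncated_moment (k : nat) : R :=
  \int[P]_w truncated_power p y (dominating k w).

(** The exponential weight, killed as soon as some bound exceeds y. *)
Let weight k (w : Omega) : R :=
  (\prod_(i < k.+1) (dominating i w <= y)%R%:R) * expR (h * (M k (path w) - m0)).

Lemma weight_ge0 k w : 0 <= weight k w.
Proof. by rewrite mulr_ge0 ?expR_ge0// prodr_ge0. Qed.

Lemma past_measurable_weight k : (k <= N)%N ->
  measurable_fun [set: past k.+1] (weight k : past k.+1 -> R).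
Proof.
move=> kN; apply: measurable_funM.
  apply: measurable_prod => i _; apply: measurable_le_natr.
  exact: past_measurable_dominating.
apply: (measurableT_comp (@measurable_expR R)).
apply: measurable_funM => //; apply: measurable_funB => //.
exact: past_measurable_M.
Qed.

Lemma weight_bound k : (k <= N)%N ->
  (\int[P]_w (weight k w)%:E <=
   (expR (\sum_(i < k.+1) (expR p / 2 * h ^+ 2 * variance_bound i +
      expR_excess p h y * truncated_moment i)))%:E)%E.
Proof.
elim: k => [_|k IH kN].
  rewrite big_ord1 /weight.
  under eq_integral do rewrite big_ord1.
  apply: integral_truncated_expR_le => //.
  - exact: measurable_dominating.
  - by apply: measurable_funB => //; exact: measurable_M.
  - exact: initial_increment_le.
  - exact: expectation_initial_increment.
  - exact: dominating_moment2.
rewrite big_ord_recr/= expRD mulrC EFinM.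
pose G (z : borel Y) := Kgeom rho (N - k.+1) * mean_dist_eps z.
have mG : measurable_fun [set: borel Y] G.
  by apply: measurable_funM => //; exact: measurable_mean_dist_eps.
have -> : (\int[P]_w (weight k.+1 w)%:E = \int[P]_w (weight k (past_id k.+1 w) *
    ((G (eps k.+2 w) <= y)%R%:R * expR (h * D (past_id k.+1 w, eps k.+2 w))))%:E)%E.
  apply: eq_integral => w _; rewrite DE /weight big_ord_recr/= -/(G _); congr EFin.
  rewrite mulrACA -expRD; congr (_ * expR _).
  by rewrite -mulrDr [in RHS]addrC subrKA.
apply: le_trans (lee_wpmul2l _ (IH (ltnW kN))); last by rewrite lee_fin expR_ge0.
apply: expectation_truncated_expR_step => //.
- exact: past_eps_indep.
- exact: (past_measurable_weight (ltnW kN)).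
- exact: weight_ge0.
- exact: measurable_D.
- move=> u z.
  exact: (doob_increment_le sepY int_eps rho0 C0 F_contr F_lip phi_lip).
- by move=> u; case: (D_integral u kN).
- exact: (dominating_moment2 k.+1).
Qed.

Definition tail_event (x : R) : set Omega :=
  [set w | (x < phi (path w) - \int[P]_w' phi (path w'))%R /\
           forall i, (i < N.+1)%N -> (dominating i w <= y)%R].

Lemma measurable_phi_path : measurable_fun [set: Omega] (fun w => phi (path w)).
Proof. by have := measurable_M (leqnn N); rewrite /M doobN. Qed.

Lemma integrable_phi_path :
  P.-integrable [set: Omega] (EFin \o (fun w => phi (path w))).
Proof. by have [] := expectation_M (leqnn N); rewrite /M doobN. Qed.

Lemma measurable_tail_event x : measurable (tail_event x).
Proof.
set m := \int[P]_w' phi (path w').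
have -> : tail_event x = (fun w => phi (path w)) @^-1` `]x + m, +oo[ `&`
    \bigcap_(i in [set i | (i < N.+1)%N]) (dominating i @^-1` `]-oo, y]).
  apply/seteqP; split => w; rewrite /tail_event/= in_itv/= andbT ltrBrDr.
    by move=> [? dy]; split => // i iN; rewrite /= in_itv/=; exact: dy.
  by move=> [? dy]; split => // i /dy; rewrite /= in_itv.
apply: measurableI.
  by rewrite -[X in measurable X]setTI; exact: measurable_phi_path.
apply: bigcap_measurableType => i _.
by rewrite -[X in measurable X]setTI; exact: measurable_dominating.
Qed.

(** Markov's inequality for the killed exponential weight. *)
Lemma one_sided_tail x :
  (P (tail_event x) <=
   (expR (- (h * x) + expR p / 2 * h ^+ 2 * (\sum_(i < N.+1) variance_bound i) +
      expR_excess p h y * \sum_(i < N.+1) truncated_moment i))%:E)%E.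
Proof.
have [_ EM] := expectation_M (leqnn N).
have m0E : m0 = \int[P]_w' phi (path w').
  by rewrite -[LHS]/(fine m0%:E) -EM /M doobN.
have mw : measurable_fun [set: Omega] (weight N).
  apply: measurable_funM.
    apply: measurable_prod => i _; apply: measurable_le_natr.
    exact: measurable_dominating.
  apply: (measurableT_comp (@measurable_expR R)).
  apply: measurable_funM => //; apply: measurable_funB => //.
  exact: measurable_M.
have mA := measurable_tail_event x.
rewrite -[tail_event x]setIT -integral_indic//.
apply: (@le_trans _ _ (\int[P]_w ((expR (- (h * x)))%:E * (weight N w)%:E))%E).
  apply: ge0_le_integral => //.
  - by apply/measurable_EFinP; exact: measurable_indic.
  - by apply: measurable_funeM; exact/measurable_EFinP.
  move=> w _; rewrite -EFinM lee_fin indicE.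
  have [|_] := boolP (w \in _); last by rewrite mulr_ge0 ?expR_ge0 ?weight_ge0.
  rewrite inE => -[xS dy].
  rewrite /weight big1 ?mul1r; last by move=> i _; rewrite dy.
  rewrite -expRD -expR0 ler_expR /M doobN m0E -mulrN -mulrDr.
  by rewrite mulr_ge0 ?(ltW h0)// addrC subr_ge0 ltW.
rewrite ge0_integralZl//; last 2 first.
- exact/measurable_EFinP.
- by move=> w _; rewrite lee_fin weight_ge0.
rewrite -addrA expRD EFinM lee_wpmul2l ?lee_fin ?expR_ge0//.
apply: (le_trans (weight_bound (leqnn N))).
by rewrite lee_fin ler_expR big_split/= -!mulr_sumr.
Qed.

End chernoff.

End functional.

Section fuk_nagaev.
Variables (p A1 A2 : R).
Hypotheses (p2 : 2 <= p) (V10 : 0 < V1) (V20 : 0 < V2).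
Hypothesis momentp_X1 :
  (\int[P]_w (mean_dist_X1 (X 1%N w) `^ p)%:E <= A1%:E)%E.
Hypothesis momentp_eps :
  (\int[P]_w (mean_dist_eps (eps 1%N w) `^ p)%:E <= A2%:E)%E.

Definition moment_bound (k : nat) : R :=
  if k is k'.+1 then A2 * Kgeom rho (N - k) `^ p else A1 * Kgeom rho N `^ p.

Lemma dominating_moment_p k y : 0 < y ->
  (\int[P]_w ((dominating k w / y) `^ p)%:E <=
   (moment_bound k * (y^-1) `^ p)%:E)%E.
Proof.
move=> y0; have iy0 : 0 <= y^-1 by rewrite invr_ge0 ltW.
have scale (c v : R) (h : Omega -> R) : measurable_fun [set: Omega] h ->
    0 <= c -> (forall w, 0 <= h w) ->
    (\int[P]_w (h w `^ p)%:E <= v%:E)%E ->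
    (\int[P]_w ((c * h w / y) `^ p)%:E <= (v * c `^ p * (y^-1) `^ p)%:E)%E.
  move=> mh c0 h0 hv.
  under eq_integral => w _.
    rewrite mulrAC powRM ?mulr_ge0//; over.
  under eq_integral do rewrite EFinM.
  rewrite ge0_integralZl//=.
  - have -> : v * c `^ p * y^-1 `^ p = (c / y) `^ p * v by rewrite powRM//; ring.
    by rewrite [leRHS]EFinM lee_wpmul2l// lee_fin powR_ge0.
  - by apply/measurable_EFinP; exact: (measurableT_comp (measurable_powR p)).
  - by move=> w _; rewrite lee_fin powR_ge0.
  - by rewrite lee_fin powR_ge0.
have gX x : 0 <= mean_dist_X1 x.
  by apply: Rintegral_ge0 => ? _; exact: mdist_ge0.
have ge y' : 0 <= mean_dist_eps y'.
  by rewrite mulr_ge0//; apply: Rintegral_ge0 => ? _; exact: mdist_ge0.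
case: k => [|k].
  apply: scale; last exact: momentp_X1.
  - exact: (measurableT_comp measurable_mean_dist_X1).
  - exact: Kgeom_ge0.
  - by move=> w; exact: gX.
apply: scale.
- exact: (measurableT_comp measurable_mean_dist_eps).
- exact: Kgeom_ge0.
- by move=> w; exact: ge.
rewrite (eps_expectation (h := fun y => (mean_dist_eps y `^ p)%:E))//.
  apply/measurable_EFinP; apply: (measurableT_comp (measurable_powR p)).
  exact: measurable_mean_dist_eps.
by move=> y'; rewrite lee_fin powR_ge0.
Qed.

Lemma variance_bound_gt0 : 0 < \sum_(i < N.+1) variance_bound i.
Proof.
have K0 k : 0 < Kgeom rho k ^+ 2.
  by rewrite exprn_gt0// (lt_le_trans ltr01)// Kgeom_ge1.
rewrite big_ord_recl/=; apply: ltr_wpDr; last exact: mulr_gt0.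
by apply: sumr_ge0 => i _; rewrite ltW//; exact: mulr_gt0.
Qed.

(** Cover the deviation by the large bounds and by the two one-sided tail events,
    for phi and - phi; the same h serves both, since the variances and the
    truncated moments depend on the bounds only. *)
Lemma fuk_nagaev_deviation (phi : (nat -> E) -> R) x
    (S := fun w => phi (fun i => X i.+1 w)) :
  (forall x x', `|phi x - phi x'| <= mdist_upto N 1 x x') -> 0 < x ->
  (P [set w | (x < `|S w - \int[P]_w' S w'|)%R] <=
   (2 * (1 + 2 / p) `^ p * ((\sum_(i < N.+1) moment_bound i) / x `^ p) +
    2 * expR (- (2 / ((p + 2) ^+ 2 * expR p)) *
      (x ^+ 2 / \sum_(i < N.+1) variance_bound i)))%:E)%E.
Proof.
move=> phi_lip x0.
have p0 : 0 < p by exact: lt_le_trans p2.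
have pp0 : 0 < p + 2 by exact: addr_gt0.
pose psi x := - phi x.
have psi_lip x1 x2 : `|psi x1 - psi x2| <= mdist_upto N 1 x1 x2.
  by rewrite /psi -opprD normrN.
pose y := x * p / (p + 2).
have y0 : 0 < y by rewrite divr_gt0 ?mulr_gt0.
pose a := \sum_(i < N.+1) truncated_moment p y i.
have tm0 i : 0 <= truncated_moment p y i.
  by apply: Rintegral_ge0 => w _; exact: truncated_power_ge0.
have a0 : 0 <= a by apply: sumr_ge0.
have [h h0] := chernoff_optimization p2 x0 variance_bound_gt0 a0.
rewrite -/y; set T := expR (- _ * _) => opt.
have Pphi : (P (tail_event phi y x) <= (a + T)%:E)%E.
  by apply: (le_trans (one_sided_tail phi_lip p0 h0 y0 x)); rewrite lee_fin.
have Ppsi : (P (tail_event psi y x) <= (a + T)%:E)%E.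
  by apply: (le_trans (one_sided_tail psi_lip p0 h0 y0 x)); rewrite lee_fin.
have iS := integrable_phi_path phi_lip.
have mS := measurable_phi_path phi_lip.
set m := \int[P]_w' S w'.
have psi_mean : \int[P]_w' psi (fun i => X i.+1 w') = - m.
  rewrite /psi -[RHS]mulN1r -RintegralZl//.
  by apply: eq_Rintegral => w _; rewrite mulN1r.
pose B (i : nat) := [set w | (y < dominating i w)%R].
have mgt (g : Omega -> R) c : measurable_fun [set: Omega] g ->
    measurable [set w | c < g w].
  move=> mg; rewrite (_ : [set w | _] = g @^-1` `]c, +oo[).
    by rewrite -[X in measurable X]setTI; exact: mg.
  by apply/seteqP; split => w /=; rewrite in_itv/= andbT.
have mB i : measurable (B i) by apply: mgt; exact: measurable_dominating.
have mU : measurable (\big[setU/set0]_(i < N.+1) B i).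
  exact: bigsetU_measurable.
have mphi := measurable_tail_event phi_lip y x.
have mpsi := measurable_tail_event psi_lip y x.
have cover : [set w | x < `|S w - m|] `<=`
    \big[setU/set0]_(i < N.+1) B i `|` (tail_event phi y x `|` tail_event psi y x).
  move=> w /= xS; have [[i yi]|nB] := pselect (exists i : 'I_N.+1, B i w).
    by left; rewrite -bigcup_seq; exists i => //=; rewrite mem_index_enum.
  right.
  have dy i : (i < N.+1)%N -> dominating i w <= y.
    move=> iN; rewrite leNgt; apply/negP => yd; apply: nB.
    by exists (Ordinal iN).
  move: xS; rewrite ltr_normr => /orP[xS|xS]; [left|right]; split => //.
  by rewrite psi_mean opprK /psi addrC -opprB.
have mxS : measurable [set w | x < `|S w - m|].
  apply: mgt; apply: (measurableT_comp (@normr_measurable R _)).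
  exact: measurable_funB.
(* The tails and the truncated moments share one moment of order p. *)
have moments : \sum_(i < N.+1) fine (P (B i)) + a <=
    (\sum_(i < N.+1) moment_bound i) * (y^-1) `^ p.
  rewrite -big_split mulr_suml; apply: ler_sum => i _.
  have mi := measurable_dominating (i : nat).
  have := tail_add_truncated_moment_le P (ltW p0) y0 (dominating_ge0 i) mi.
  move=> /le_trans/(_ (dominating_moment_p i y0)).
  have tfin := integrable_truncated_power P (ltW p0) y0 (dominating_ge0 i) mi.
  rewrite -[X in (X + _)%E](@fineK _ (P (B i))) ?fin_num_measure//.
  rewrite -[X in (_ + X)%E]fineK; last exact: (integrable_fin_num measurableT tfin).
  by rewrite -EFinD lee_fin.
have yE : (y^-1) `^ p = (1 + 2 / p) `^ p / x `^ p.
  have -> : y^-1 = (1 + 2 / p) * x^-1.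
    by rewrite /y; field; rewrite !gt_eqF.
  rewrite powRM ?invr_ge0 ?ltW// ?addr_gt0 ?divr_gt0//.
  by rewrite -(powR_inv1 (ltW x0)) powRAC powR_inv1 ?powR_ge0.
apply: (@le_trans _ _ (P (\big[setU/set0]_(i < N.+1) B i `|`
    (tail_event phi y x `|` tail_event psi y x)))).
  by apply: le_measure => //; rewrite inE//; do !apply: measurableU.
apply: (le_trans (measureU2 _ _ _)) => //; first exact: measurableU.
have -> : (2 * (1 + 2 / p) `^ p * ((\sum_(i < N.+1) moment_bound i) / x `^ p) +
    2 * T) = 2 * ((\sum_(i < N.+1) moment_bound i) * (y^-1) `^ p) + 2 * T.
  by rewrite yE; ring.
have b0 : 0 <= \sum_(i < N.+1) fine (P (B i)).
  by apply: sumr_ge0 => i _; rewrite fine_ge0.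
apply: (@le_trans _ _ ((\sum_(i < N.+1) fine (P (B i)))%:E +
    ((a + T)%:E + (a + T)%:E))%E); last by rewrite -!EFinD lee_fin; lra.
apply: leeD.
  apply: (le_trans (Boole_inequality _ _)) => //.
  rewrite -sumEFin; apply: lee_sum => i _.
  by rewrite fineK ?fin_num_measure.
by apply: (le_trans (measureU2 _ _ _)) => //; exact: leeD.
Qed.

End fuk_nagaev.
End chain.

(** * Finiteness of the mean distances *)

(** A finite second moment is the only source of integrability at hand: it makes
    the mean distance finite at one point, hence everywhere by the triangle
    inequality ([integrable_mdist]). *)
Lemma moment2_finite_somewhere d (T : measurableType d) (R : realType)
    (P : probability T R) (g : T -> \bar R) (v : R) :
  (forall t, 0 <= g t)%E -> (\int[P]_t (g t ^+ 2) <= v%:E)%E ->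
  exists t, (g t < +oo)%E.
Proof.
move=> g0 gv; apply: contrapT => goo.
have gE t : g t = +oo%E.
  apply/eqP; rewrite -leye_eq leNgt; apply/negP => gt; apply: goo.
  by exists t.
move: gv; under eq_integral do rewrite gE.
rewrite (_ : (fun t => _) = cst +oo%E); last by apply/funext.
rewrite integral_cst// [X in (_ * X)%E](_ : _ = 1%E) ?mule1 ?leye_eq//.
exact: probability_setT.
Qed.

Lemma integrable_mdist (R : realType) (T : completeMetricType R)
    (nu : probability (borel T) R) (z : T) :
  (\int[nu]_x (mdist z x)%:E < +oo)%E -> forall x : T,
  nu.-integrable [set: borel T] (EFin \o (mdist x : borel T -> R)).
Proof.
have mm x : measurable_fun [set: borel T] (mdist x : borel T -> R).
  rewrite (_ : mdist x = fun y => mdist y x); first exact: measurable_mdistl.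
  by apply/funext => y; exact: metric_sym.
move=> zoo x.
have iz : nu.-integrable [set: borel T] (EFin \o (mdist z : borel T -> R)).
  apply/integrableP; split; first exact/measurable_EFinP.
  by under eq_integral do rewrite /= ger0_norm ?mdist_ge0//.
apply: (integrable_EFin_norm_le (mm x) _
  (integrable_EFinD (integrable_EFin_cst nu (mdist x z)) iz)) => y.
by rewrite ger0_norm ?mdist_ge0//; exact: metric_triangle.
Qed.

Theorem proposition3p10 (R : realType)
  (E : completeMetricType R) (Y : completeMetricType R)
  (sepE : separable_space E) (sepY : separable_space Y)
  (d : measure_display) (Omega : measurableType d) (P : probability Omega R)
  (* eps 0 and X 0 are not used: the sequences start at index 1 *)
  (eps : nat -> {RV P >-> borel Y}) (X : nat -> {RV P >-> borel E})
  (iid_eps : iid [set i | (1 <= i)%N] eps)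
  (indep_X1 : independent_systems P
     (g_sigma_algebra_preimage (X 1%N)) (sigma_family [set i | (2 <= i)%N] eps))
  (F : E -> Y -> E)
  (mF : measurable_fun [set: borel E * borel Y]
     (fun z : borel E * borel Y => (F z.1 z.2 : borel E)))
  (chain : forall (k : nat) (w : Omega), (2 <= k)%N ->
     X k w = F (X k.-1 w) (eps k w))
  (rho C : R) (rho_ge0 : 0 <= rho) (rho_lt1 : rho < 1) (C_gt0 : 0 < C)
  (F_contr : forall x x' : E,
     ('E_P[fun w => mdist (F x (eps 1%N w)) (F x' (eps 1%N w))]
        <= (rho * mdist x x')%:E)%E)
  (F_lip : forall (x : E) (y y' : Y),
     mdist (F x y) (F x y') <= C * mdist y y')
  (n : nat) (n_ge1 : (1 <= n)%N)
  (f : ('I_n -> E) -> R)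
  (f_lip : forall x x' : 'I_n -> E,
     `|f x - f x'| <= \sum_(i < n) mdist (x i) (x' i))
  (p : R) (p_ge2 : 2 <= p)
  (V1 V2 A1 A2 : R)
  (V1_gt0 : 0 < V1) (V2_gt0 : 0 < V2) (A1_gt0 : 0 < A1) (A2_gt0 : 0 < A2) :
  let S : Omega -> R := centered P (fun w => f (fun i : 'I_n => X i.+1 w)) in
  let GX1 : E -> \bar R := fun x =>
    (\int[distribution P (X 1%N)]_x' (mdist x (x' : E))%:E)%E in
  let Geps : Y -> \bar R := fun y =>
    (\int[distribution P (eps 1%N)]_y' (C * mdist y (y' : Y))%:E)%E in
  let K : nat -> R := Kgeom rho in
  let V : R := V1 * K n.-1 ^+ 2 + V2 * \sum_(2 <= i < n.+1) K (n - i)%N ^+ 2 in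
  let A : R :=
    A1 * K n.-1 `^ p + A2 * \sum_(2 <= i < n.+1) K (n - i)%N `^ p in
  (\int[P]_w (GX1 (X 1%N w) ^+ 2) <= V1%:E)%E ->
  (\int[P]_w (Geps (eps 1%N w) ^+ 2) <= V2%:E)%E ->
  (\int[P]_w (GX1 (X 1%N w) `^ p) <= A1%:E)%E ->
  (\int[P]_w (Geps (eps 1%N w) `^ p) <= A2%:E)%E ->
  forall x : R, 0 < x ->
    (P [set w | (x < `|S w|)%R] <=
      (2 * (1 + 2 / p) `^ p * (A / x `^ p)
       + 2 * expR (- (2 / ((p + 2) ^+ 2 * expR p)) * (x ^+ 2 / V)))%:E)%E.
Proof.
move=> S GX1 Geps K V A GX1_2 Geps_2 GX1_p Geps_p x x0.
case: n n_ge1 f f_lip @S @V @A => // N _ f' f'_lip S V A.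
have C0 := ltW C_gt0.
have GX1_ge0 z : (0 <= GX1 z)%E.
  by apply: integral_ge0 => z' _; rewrite lee_fin mdist_ge0.
have Geps_ge0 z : (0 <= Geps z)%E.
  by apply: integral_ge0 => z' _; rewrite lee_fin mulr_ge0 ?mdist_ge0.
have int_X1 z : (distribution P (X 1%N)).-integrable [set: borel E]
    (EFin \o (mdist z : borel E -> R)).
  have [w w_fin] := moment2_finite_somewhere (fun w => GX1_ge0 (X 1%N w)) GX1_2.
  exact: (integrable_mdist w_fin).
have int_eps z : (distribution P (eps 1%N)).-integrable [set: borel Y]
    (EFin \o (mdist z : borel Y -> R)).
  have [w w_fin] := moment2_finite_somewhere (fun w => Geps_ge0 (eps 1%N w)) Geps_2.
  apply: (@integrable_mdist _ _ _ (eps 1%N w)).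
  move: w_fin; rewrite /Geps; under eq_integral do rewrite EFinM.
  have mm : measurable_fun [set: borel Y]
      (fun y => (mdist (eps 1%N w : Y) y)%:E).
    apply/measurable_EFinP.
    rewrite (_ : mdist _ = fun y => mdist y (eps 1%N w : Y)).
      exact: measurable_mdistl.
    by apply/funext => y; exact: metric_sym.
  rewrite ge0_integralZl//; last by move=> y _; rewrite lee_fin mdist_ge0.
  by case: (\int[_]_y _)%E => [r| |]; rewrite ?ltry ?ltNyr// gt0_muley ?lte_fin.
have GX1E z : GX1 z = (mean_dist_X1 X z)%:E.
  rewrite /mean_dist_X1 /Rintegral fineK//.
  exact: (integrable_fin_num measurableT (int_X1 z)).
have GepsE z : Geps z = (mean_dist_eps eps C z)%:E.
  rewrite /Geps; under eq_integral do rewrite EFinM.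
  rewrite integralZl//; last exact: int_eps.
  rewrite /mean_dist_eps /Rintegral EFinM fineK//.
  exact: (integrable_fin_num measurableT (int_eps z)).
have F_contr' z z' : (\int[distribution P (eps 1%N)]_y (mdist (F z y) (F z' y))%:E
    <= (rho * mdist z z')%:E)%E.
  have := F_contr z z'; rewrite unlock.
  rewrite ge0_integral_distribution//; last by move=> y; rewrite lee_fin mdist_ge0.
  apply/measurable_EFinP; apply: (measurable_lipschitz sepY (L := C + C)).
    exact: addr_ge0.
  exact: mdist_comp_lip (F_lip z) (F_lip z').
(* The i-th entry of a path is X_(i+1), and the last one has index N = n - 1. *)
pose phi (u : nat -> E) : R := f' (fun i => u i).
have phi_lip u u' : `|phi u - phi u'| <= mdist_upto N 1 u u'.
  rewrite /mdist_upto mul1r -(big_ord_recr N (fun i => mdist (u i) (u' i))).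
  exact: f'_lip.
have VE : \sum_(i < N.+1) variance_bound rho N V1 V2 i = V.
  rewrite big_ord_recl /V/=; congr (_ + _).
  rewrite mulr_sumr !big_add1 big_mkord; apply: eq_bigr => i _.
  by rewrite subSS.
have AE : \sum_(i < N.+1) moment_bound rho N p A1 A2 i = A.
  rewrite big_ord_recl /A/=; congr (_ + _).
  rewrite mulr_sumr !big_add1 big_mkord; apply: eq_bigr => i _.
  by rewrite subSS.
have SE w : S w = phi (fun i => X i.+1 w) - \int[P]_w' phi (fun i => X i.+1 w').
  by rewrite /S /centered unlock.
rewrite -VE -AE.
rewrite (_ : [set w | _] =
  [set w | x < `|phi (fun i => X i.+1 w) - \int[P]_w' phi (fun i => X i.+1 w')|]).
  apply: (fuk_nagaev_deviation sepE sepY iid_eps indep_X1 mF chain rho_ge0 C0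
    F_contr' F_lip int_eps int_X1 _ _ p_ge2 V1_gt0 V2_gt0) => //.
  - by move: GX1_2; under eq_integral do rewrite GX1E -EFin_expe.
  - by move: Geps_2; under eq_integral do rewrite GepsE -EFin_expe.
  - by move: GX1_p; under eq_integral do rewrite GX1E poweR_EFin.
  - by move: Geps_p; under eq_integral do rewrite GepsE poweR_EFin.
by apply/seteqP; split => w /=; rewrite SE.
Qed.
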